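(* Let $k\in\{2,3\}$, let $\{a_n\}_{n\ge 1}$ be a $k$-periodic sequence of positive real numbers, let $x_1,x_2>0$, and let $\{x_n\}_{n\ge1}$ be the sequence defined by $$x_{n+2}=\frac{a_n+x_{n+1}}{x_n},\qquad n\ge 1.$$ Then $\{x_n\}_n$ is persistent. Furthermore, either (a) the sequence $\{x_n\}_n$ is periodic, with period a multiple of $k$; or (b) the sequence $\{x_n\}_n$ densely fills one or two (resp. one, two or three) disjoint intervals of $\mathbb{R}^+$ when $\{a_n\}_n$ is $2$-periodic (resp. $3$-periodic). Moreover, it is possible by algebraic tools to distinguish which is the situation.
   Context: $\mathbb{R}^+=(0,\infty)$. The sequence $\{a_n\}_n$ is $k$-periodic if $a_{n+k}=a_n$ for all $n\ge 1$. A sequence $\{x_n\}_n$ is called persistent if there exist two positive real constants $c,C$, depending on the initial conditions $x_1,x_2$, such that $0<c<x_n<C<\infty$ for all $n\ge 1$. ''Periodic with period a multiple of $k$'' means that there is a positive integer $p$, divisible by $k$, with $x_{n+p}=x_n$ for all $n\ge1$. ''Densely fills $m$ disjoint intervals'' means that the closure of $\{x_n:n\ge 1\}$ is the union of $m$ pairwise disjoint nondegenerate closed intervals. The ''algebraic tools'' that distinguish the number of intervals are computations of discriminants and resultants, as follows. For $k=2$ write $a_n=a$ for $n$ odd and $a_n=b$ for $n$ even, put $$V_{b,a}(x,y)=\frac{ax^2y+bxy^2+bx^2+ay^2+(b^2+a)x+(b+a^2)y+ab}{xy},$$ and let $V_{a,b}$ be obtained by interchanging $a$ and $b$. For $k=3$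 write $a_n=a,b,c$ for $n\equiv 1,2,0 \pmod 3$ respectively, put $$V_{c,b,a}(x,y)=\frac{cx^2y+axy^2+bx^2+by^2+(a+bc)x+(c+ab)y+ac}{xy},$$ and let $V_{a,c,b}$, $V_{b,a,c}$ be obtained by the corresponding relabelling of the parameters. With $h=V_{b,a}(x_1,x_2)$ (resp. $h=V_{c,b,a}(x_1,x_2)$), in case (b) the closure of $\{x_n\}_n$ is the union of the projections on the $x$-axis of the level sets, in the open first quadrant, $\{V_{b,a}=h\}$ and $\{V_{a,b}=h\}$ (resp. $\{V_{c,b,a}=h\}$, $\{V_{a,c,b}=h\}$ and $\{V_{b,a,c}=h\}$). The endpoints of these projections are zeros of the discriminants with respect to $y$ of the polynomials $xyV(x,y)-hxy$, for $V$ each of these functions; the pairwise resultants with respect to $x$ of these discriminants are, for fixed parameters, polynomials in $h$, and a subset of their zeros gives the bifurcation values of $h$ that separate the different numbers of intervals. *)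

(* Defs.v *)
From HB Require Import structures.
From mathcomp Require Export all_boot all_order all_algebra.
From mathcomp Require Import ring.
From mathcomp Require Export all_classical all_reals all_analysis.
Export Order.TTheory GRing.Theory Num.Theory numFieldNormedType.Exports.

Set Implicit Arguments.
Unset Strict Implicit.
Unset Printing Implicit Defensive.

Local Open Scope classical_set_scope.
Local Open Scope ring_scope.

(* Sequences are functions on nat, only looked at for indices n >= 1: the value
   at 0 plays no role. *)

Definition periodic (T : Type) (p : nat) (u : nat -> T) : Prop :=
  forall n : nat, (1 <= n)%N -> u (n + p)%N = u n.

Definition persistent (R : realType) (x : nat -> R) : Prop :=
  exists c C : R,
    [/\ 0 < c, 0 < C & forall n : nat, (1 <= n)%N -> c < x n < C].

Definition orbit_set (R : realType) (x : nat -> R) : set R :=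
  [set x n | n in [set n : nat | (1 <= n)%N]].

Definition is_disjoint_intervals (R : realType) (m : nat) (A : set R) : Prop :=
  exists l r : 'I_m -> R,
    [/\ forall i, 0 < l i < r i,
        trivIset setT (fun i => `[l i, r i]%classic)
      & A = \bigcup_(i in setT) `[l i, r i]%classic].

Definition densely_fills (R : realType) (m : nat) (x : nat -> R) : Prop :=
  is_disjoint_intervals m (closure (orbit_set x)).

(* The numerators are written over an arbitrary commutative ring, so that the
   same formula yields both the real function V and the polynomial
   x y V - h x y in the indeterminates h, x, y. *)
Definition lyness_num2 (S : comNzRingType) (b a x y : S) : S :=
  a * x ^+ 2 * y + b * x * y ^+ 2 + b * x ^+ 2 + a * y ^+ 2
  + (b ^+ 2 + a) * x + (b + a ^+ 2) * y + a * b.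

Definition lyness_num3 (S : comNzRingType) (c b a x y : S) : S :=
  c * x ^+ 2 * y + a * x * y ^+ 2 + b * x ^+ 2 + b * y ^+ 2
  + (a + b * c) * x + (c + a * b) * y + a * c.

(* The index j relabels the parameters by shifting the sequence: for
   j = 0, 1 (k = 2) these are the numerators of V_{b,a}, V_{a,b}, and for
   j = 0, 1, 2 (k = 3) those of V_{c,b,a}, V_{a,c,b}, V_{b,a,c}, where
   a, b(, c) = a_1, a_2(, a_3).  Only k = 2 and k = 3 are meaningful. *)
Definition lyness_num (S : comNzRingType) (k : nat) (a : nat -> S) (j : nat)
    (x y : S) : S :=
  if k == 2%N then lyness_num2 (a (j + 2)%N) (a (j + 1)%N) x y
  else lyness_num3 (a (j + 3)%N) (a (j + 2)%N) (a (j + 1)%N) x y.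

Definition lyness_V (R : realType) (k : nat) (a : nat -> R) (j : nat)
    (x y : R) : R :=
  lyness_num k a j x y / (x * y).

Definition level_set (R : realType) (k : nat) (a : nat -> R) (j : nat)
    (h : R) : set (R * R) :=
  [set p | [/\ 0 < p.1, 0 < p.2 & lyness_V k a j p.1 p.2 = h]].

Definition level_proj (R : realType) (k : nat) (a : nat -> R) (j : nat)
    (h : R) : set R :=
  fst @` level_set k a j h.

Definition level_projs (R : realType) (k : nat) (a : nat -> R)
    (h : R) : set R :=
  \bigcup_(j in [set j : nat | (j < k)%N]) level_proj k a j h.

(* The polynomial x y V(x,y) - h x y as an element of R[h][x][y]: the
   outermost variable is y, then x, and the innermost one is h. *)
Definition level_poly (R : realType) (k : nat) (a : nat -> R) (j : nat) :
    {poly {poly {poly R}}} :=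
  let h : {poly {poly {poly R}}} := (('X : {poly R})%:P)%:P in
  let x : {poly {poly {poly R}}} := ('X : {poly {poly R}})%:P in
  let y : {poly {poly {poly R}}} := 'X in
  lyness_num k (fun n => (((a n)%:P)%:P)%:P) j x y - h * x * y.

Lemma rmorph_lyness_num (S T : comNzRingType) (f : {rmorphism S -> T})
    (k : nat) (a : nat -> S) (j : nat) (x y : S) :
  f (lyness_num k a j x y) = lyness_num k (fun n => f (a n)) j (f x) (f y).
Proof.
by rewrite /lyness_num; case: ifP => _;
  rewrite /lyness_num2 /lyness_num3 !(rmorphD, rmorphM, rmorphXn).
Qed.

Lemma eq_lyness_num (S : comNzRingType) (k : nat) (a a' : nat -> S) (j : nat)
    (x x' y y' : S) :
  a =1 a' -> x = x' -> y = y' ->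
  lyness_num k a j x y = lyness_num k a' j x' y'.
Proof. by move=> ea -> ->; rewrite /lyness_num !ea. Qed.

Lemma level_polyE (R : realType) (k : nat) (a : nat -> R) (j : nat)
    (h x y : R) (hx : x != 0) (hy : y != 0) :
  (level_poly k a j).[(y%:P)%:P].[x%:P].[h]
  = x * y * lyness_V k a j x y - h * x * y.
Proof.
rewrite /lyness_V mulrC divfK ?mulf_neq0 //.
pose e3 : {rmorphism _ -> _} := horner_eval ((y%:P)%:P : {poly {poly R}}).
pose e2 : {rmorphism _ -> _} := horner_eval (x%:P : {poly R}).
pose e1 : {rmorphism _ -> _} := horner_eval h.
rewrite /level_poly !hornerD !hornerN !hornerM !(hornerC, hornerX).
congr (_ - _).
rewrite -[LHS]/(e1 (e2 (e3 _))) !rmorph_lyness_num /= /horner_eval.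
apply: eq_lyness_num => [n||]; first by rewrite !hornerC.
  by rewrite hornerC hornerX hornerC.
by rewrite hornerX !hornerC.
Qed.

Lemma lyness_num_quadratic (S : comNzRingType) (k : nat) (a : nat -> S)
    (j : nat) (h x : S) :
  exists A B C : S,
    lyness_num k (fun n => (a n)%:P) j x%:P 'X - h%:P * x%:P * 'X
    = A *: 'X^2 + B *: 'X + C%:P.
Proof.
rewrite /lyness_num; case: ifP => _.
  move: (a (j + 1)%N) (a (j + 2)%N) => c b.
  exists (b * x + c), (c * x ^+ 2 + (b + c ^+ 2) - h * x),
    (b * x ^+ 2 + (b ^+ 2 + c) * x + c * b).
  by rewrite /lyness_num2 -!mul_polyC; ring.
move: (a (j + 1)%N) (a (j + 2)%N) (a (j + 3)%N) => c b d.
exists (c * x + b), (d * x ^+ 2 + (d + c * b) - h * x),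
  (b * x ^+ 2 + (c + b * d) * x + c * d).
by rewrite /lyness_num3 -!mul_polyC; ring.
Qed.

Lemma size_level_poly (R : realType) (k : nat) (a : nat -> R) (j : nat) :
  (size (level_poly k a j) <= 3)%N.
Proof.
have [A [B [C e]]] := lyness_num_quadratic k
  (fun n => ((a n)%:P)%:P : {poly {poly R}}) j ('X : {poly R})%:P 'X.
rewrite /level_poly e.
rewrite (leq_trans (size_polyD _ _)) // geq_max.
rewrite (leq_trans (size_polyC_leq1 _)) // andbT.
rewrite (leq_trans (size_polyD _ _)) // geq_max.
rewrite (leq_trans (size_scale_leq _ _)) ?size_polyXn //=.
by rewrite (leq_trans (size_scale_leq _ _)) ?size_polyX.
Qed.

(* B ^ 2 - 4 A C for a polynomial A y^2 + B y + C of degree 2. *)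
Definition discriminant2 (S : comNzRingType) (p : {poly S}) : S :=
  p`_1 ^+ 2 - 4 * p`_2 * p`_0.

(* Discriminant with respect to y, an element of R[h][x]. *)
Definition level_disc (R : realType) (k : nat) (a : nat -> R) (j : nat) :
    {poly {poly R}} :=
  discriminant2 (level_poly k a j).

(* Resultant with respect to x of two discriminants, an element of R[h]. *)
Definition level_res (R : realType) (k : nat) (a : nat -> R) (i j : nat) :
    {poly R} :=
  resultant (level_disc k a i) (level_disc k a j).

(* h lies strictly above the minimum of V on the open quadrant, i.e. its level
   sets are neither empty nor reduced to a point.  All the functions V of the
   family have the same range there, so j = 0 suffices. *)
Definition nondegenerate_level (R : realType) (k : nat) (a : nat -> R)
    (h : R) : Prop :=
  exists u v : R, [/\ 0 < u, 0 < v & lyness_V k a 0 u v < h].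

(* The number of intervals is not locally constant at h. *)
Definition bifurcation_value (R : realType) (k : nat) (a : nat -> R)
    (h : R) : Prop :=
  nondegenerate_level k a h /\
  ~ exists m : nat,
      \forall h' \near h, is_disjoint_intervals m (level_projs k a h').

(* Main.v *)
(* Let P = x y (V - h) be the numerator of a level. Each Lyness map carries P = 0
   for one value of j to P = 0 for the next one, and it carries the Hamiltonian
   flow x' = dP/dy, y' = - dP/dx to the corresponding flow. The discriminant D of
   P with respect to y is a quartic in x with four simple real roots
   0 <= e1 < l < r < e4, and the part of P = 0 in the open quadrant is an oval
   above [l, r]. Along the flow x' = sqrt D(x) up to sign, so the oval is a single
   periodic orbit of the flow, and by uniqueness of solutions the k-fold
   composition of Lyness maps is a time shift on it. A shift by a rational
   multiple of the period makes x periodic; otherwise the orbit is dense in the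
   oval, and the closure of x is the union of the k projections.

   The endpoints l and r depend continuously on h, so the number of intervals can
   only change at a level where the right endpoint of one projection is the left
   endpoint of another; the two discriminants then share a root and their
   resultant vanishes. The polynomial D = (A - h x)^2 - B determines the
   projection, and two of the discriminants have an identically zero resultant
   only if they are equal, in which case the two projections coincide. *)
From mathcomp Require Import ring lra.
Require Import Defs.

Set Implicit Arguments.
Unset Strict Implicit.
Unset Printing Implicit Defensive.

Local Open Scope classical_set_scope.
Local Open Scope ring_scope.

(** * Scalar differential equations *)

Lemma is_derive1_continuous (R : realType) (f : R -> R) (x d : R) :
  is_derive x 1 f d -> {for x, continuous f}.
Proof. by move=> fd; apply/differentiable_continuous/derivable1_diffP. Qed.

Lemma is_derive1_le (R : realType) (f f' : R -> R) (a b : R) :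
  (forall x, a <= x <= b -> is_derive x 1 f (f' x)) ->
  (forall x, a <= x <= b -> 0 <= f' x) -> a <= b -> f a <= f b.
Proof.
move=> fd f0 ab; have [x xab||c cab e] := @MVT_segment R f f' a b ab.
- by apply: fd; move: xab; rewrite in_itv /= => /andP[/ltW-> /ltW->].
- apply: continuous_in_subspaceT => x; rewrite inE /= in_itv /= => xab.
  exact: is_derive1_continuous (fd _ xab).
- by rewrite -subr_ge0 e mulr_ge0 ?subr_ge0 // f0 //; move: cab; rewrite in_itv.
Qed.

Lemma is_derive1_lt (R : realType) (f f' : R -> R) (a b : R) :
  (forall x, a <= x <= b -> is_derive x 1 f (f' x)) ->
  (forall x, a <= x <= b -> 0 < f' x) -> a < b -> f a < f b.
Proof.
move=> fd f0 ab; have [x xab||c cab e] := @MVT_segment R f f' a b (ltW ab).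
- by apply: fd; move: xab; rewrite in_itv /= => /andP[/ltW-> /ltW->].
- apply: continuous_in_subspaceT => x; rewrite inE /= in_itv /= => xab.
  exact: is_derive1_continuous (fd _ xab).
- by rewrite -subr_gt0 e mulr_gt0 ?subr_gt0 // f0 //; move: cab; rewrite in_itv.
Qed.

(** The integrals from [- n] are renormalised to vanish at 0, so they agree wherever two of them are
    defined. Near a given point [F] is thus one fixed integral, although its index [n] varies with
    the argument. *)
Lemma continuous_antiderivative (R : realType) (f : R -> R) :
  continuous f -> exists F : R -> R, forall x : R, is_derive x 1 F (f x).
Proof.
move=> fC.
pose I (n : nat) (x : R) : R :=
  \int[@lebesgue_measure R]_(t in `[- n%:R, x]) f t.
have dI n (x : R) : - n%:R < x -> is_derive x 1 (I n) (f x).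
  move=> nx; have xx : x < x + 1 by rewrite ltrDl.
  have [|] := @continuous_FTC1_closed R f (- n%:R) x (x + 1) xx _ nx (fC x).
    apply: continuous_compact_integrable; first exact: segment_compact.
    exact: continuous_subspaceT.
  by move=> d e; have := derivableP d; rewrite -derive1E e.
pose F x := let n := (Num.truncn `|x|).+2 in I n x - I n 0.
have bound (x : R) n : (Num.truncn `|x| < n)%N -> - n%:R < x.
  move=> xn; have := truncnS_gt `|x|.
  have : ((Num.truncn `|x|).+1%:R : R) <= n%:R by rewrite ler_nat.
  have := ler_norm (- x); rewrite normrN; lra.
have indep n m (x : R) : (0 < n)%N -> - n%:R < x -> (n <= m)%N ->
    I n x - I n 0 = I m x - I m 0.
  move=> n0 nx nm.
  have nm' : (n%:R : R) <= m%:R by rewrite ler_nat.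
  have n0' : (0 : R) < n%:R by rewrite ltr0n.
  pose G t := I n t - I m t.
  have dG (t : R) : - n%:R < t -> is_derive t 1 G 0.
    move=> nt; rewrite /G; apply: is_derive_eq.
      by apply: is_deriveB; apply: dI; lra.
    by rewrite subrr.
  have dNG (t : R) : - n%:R < t -> is_derive t 1 (- G) 0.
    by move=> nt; have := dG t nt => ?; apply: is_derive_eq; rewrite oppr0.
  have key (a b : R) : - n%:R < a -> a <= b -> G a = G b.
    move=> na ab; apply/eqP; rewrite eq_le; apply/andP; split.
      apply: (@is_derive1_le _ _ (cst 0)) ab => // t /andP[at_ _].
      by apply: dG; lra.
    rewrite -lerN2; apply: (@is_derive1_le _ (- G) (cst 0)) ab => //.
    by move=> t /andP[at_ _]; apply: dNG; lra.
  suff : G x = G 0 by rewrite /G; lra.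
  case: (leP x 0) => x0; first exact: key.
  by apply/esym/key; lra.
exists F => x.
(* One more than the index used by [F] at [x], so that it serves all [y] within distance 1 of
   [x]. *)
pose N := (Num.truncn `|x|).+3.
have NE y : `|y| < `|x| + 1 -> F y = I N y - I N 0.
  move=> yx; rewrite /F /=; apply: indep => //; first exact: bound.
  have le : (Num.truncn `|y| <= (Num.truncn `|x|).+1)%N.
    rewrite truncn_le_nat (lt_trans yx) // -(natr1 (Num.truncn `|x|).+1).
    by have := truncnS_gt `|x|; lra.
  by rewrite /N !ltnS.
have dN : is_derive x 1 (fun y => I N y - I N 0) (f x).
  have := dI N x (bound _ _ _) => /(_ (leqW (leqnSn _))) ?.
  by apply: is_derive_eq; rewrite subr0.
apply: near_eq_is_derive dN.
near=> y; apply/esym/NE.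
have : `|y - x| < 1.
  by near: y; exists 1 => //= z; rewrite distrC.
by have := ler_dist_dist y x; have := ler_norm (`|y| - `|x|); lra.
Unshelve. all: by end_near. Qed.

(** Separation of variables: [th] is the inverse of an antiderivative [F] of 1/f. Since F' >= 1/C,
    [F] is onto the real line and [th] is defined for all times. *)
Lemma scalar_autonomous_ode (R : realType) (f : R -> R) (c C : R) :
  continuous f -> 0 < c -> (forall x, c <= f x <= C) ->
  exists th : R -> R,
    (forall t : R, is_derive t 1 th (f (th t))) /\
    (forall y, exists t, th t = y).
Proof.
move=> fC c0 fcC.
have f0 x : 0 < f x by apply: lt_le_trans c0 _; case/andP: (fcC x).
have C0 : 0 < C by apply: lt_le_trans (f0 0) _; case/andP: (fcC 0).
have gC : continuous (fun x => (f x)^-1).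
  by move=> x; apply: continuousV; [rewrite gt_eqF|exact: fC].
have [F dF] := continuous_antiderivative gC.
have Finc a b : a < b -> F a < F b.
  apply: (@is_derive1_lt _ F (fun x => (f x)^-1)) => // x _.
  by rewrite invr_gt0.
have Fcont : continuous F by move=> x; exact: is_derive1_continuous (dF x).
have Finj : injective F.
  move=> a b e; case: (ltgtP a b) => // /Finc; by rewrite e ltxx.
have grow a b : a <= b -> (b - a) / C <= F b - F a.
  move=> ab; rewrite lerBrDr addrC -lerBrDr.
  suff : F a - a / C <= F b - b / C by rewrite mulrBl; lra.
  apply: (@is_derive1_le _ (fun x => F x - x / C)
    (fun x => (f x)^-1 - C^-1)) ab.
    move=> x _; have dFx := dF x; apply: is_derive_eq.
    by rewrite scaler0 add0r scaler1.
  move=> x _; rewrite subr_ge0 lef_pV2 ?posrE //; by case/andP: (fcC x).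
have surj t : exists x, F x = t.
  (* By [grow], moving [M] away from 0 on either side changes [F] by at least |t - F 0|, so [t] is
     bracketed. *)
  pose M := C * `|t - F 0|.
  have M0 : 0 <= M by rewrite mulr_ge0 // ltW.
  have MC : M / C = `|t - F 0| by rewrite /M mulrAC divff ?mul1r // gt_eqF.
  have g1 := grow 0 M M0; have g2 := grow (- M) 0; rewrite oppr_le0 in g2.
  have {}g2 := g2 M0; rewrite subr0 MC in g1; rewrite sub0r opprK MC in g2.
  have n1 := ler_norm (t - F 0); have n2 := ler_norm (- (t - F 0)).
  rewrite normrN in n2.
  have [|||x _ <-] := @IVT R F (- M) M t; first lra.
  - exact: continuous_subspaceT.
  - rewrite ge_min le_max.
    by apply/andP; split; apply/orP; [left|right]; lra.
  - by exists x.
pose th t := xget 0 [set x | F x = t].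
have Fth t : F (th t) = t.
  rewrite /th; case: xgetP => [x _ //|/(_ _)].
  by have [x e] := surj t => /(_ x).
have thF x : th (F x) = x by apply: Finj; rewrite Fth.
exists th; split; last by move=> y; exists (F y).
move=> t; rewrite -{1}(Fth t) -[f _]invrK.
apply: (is_derive_inverse _ _ (dF (th t))).
- by near=> z; exact: thF.
- by near=> z; exact: Fcont.
- by rewrite invr_eq0 gt_eqF.
Unshelve. all: by end_near. Qed.

(** The energy E = d1^2 + d2^2 satisfies |E'| <= 4 K E. Hence E exp(-4Kt) does not increase for t >=
    0 and E exp(4Kt) does not decrease for t <= 0, while E(0) = 0. *)
Lemma gronwall_zero (R : realType) (d1 d2 e1 e2 : R -> R) (K : R) :
  (forall t : R, is_derive t 1 d1 (e1 t)) ->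
  (forall t : R, is_derive t 1 d2 (e2 t)) ->
  (forall t, `|e1 t| <= K * (`|d1 t| + `|d2 t|)) ->
  (forall t, `|e2 t| <= K * (`|d1 t| + `|d2 t|)) ->
  d1 0 = 0 -> d2 0 = 0 -> forall t, d1 t = 0 /\ d2 t = 0.
Proof.
move=> dd1 dd2 b1 b2 d10 d20.
wlog K0 : K b1 b2 / 0 <= K => [wl|].
  apply: (wl `|K|) => // t; apply: le_trans (ler_wpM2r _ (ler_norm K)) => //;
    by rewrite addr_ge0.
pose E t := d1 t ^+ 2 + d2 t ^+ 2.
pose E' t := 2 * d1 t * e1 t + 2 * d2 t * e2 t.
have dE (t : R) : is_derive t 1 E (E' t).
  have := dd1 t; have := dd2 t => ? ?; rewrite /E; apply: is_derive_eq.
  by rewrite /E' /GRing.scale /=; ring.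
have bE t : `|E' t| <= 4 * K * E t.
  rewrite /E' /E -(real_normK (num_real (d1 t))).
  rewrite -(real_normK (num_real (d2 t))).
  apply: le_trans (ler_normD _ _) _.
  rewrite !normrM (ger0_norm (ler0n _ 2)).
  have := b1 t; have := b2 t.
  have := normr_ge0 (d1 t); have := normr_ge0 (d2 t).
  move: `|d1 t| `|d2 t| `|e1 t| `|e2 t| => a b u v b0 a0 hv hu.
  have h1 : a * u <= a * (K * (a + b)) by rewrite ler_wpM2l.
  have h2 : b * v <= b * (K * (a + b)) by rewrite ler_wpM2l.
  (* Twice this quantity is 4K(a^2 + b^2) - 2K(a + b)^2. *)
  have h3 : 0 <= K * (a - b) ^+ 2 by rewrite mulr_ge0 // sqr_ge0.
  nra.
have E0 : E 0 = 0 by rewrite /E d10 d20 expr0n addr0.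
pose L := 4 * K.
suff EN t : E t <= 0.
  move=> t; have := EN t; rewrite /E => EE.
  have := sqr_ge0 (d1 t); have := sqr_ge0 (d2 t) => h1 h2.
  by split; apply/eqP; rewrite -sqrf_eq0 eq_le; apply/andP; split=> //; lra.
have eL (s a : R) :
    is_derive s 1 (fun s => expR (a * s)) (a * expR (a * s)).
  rewrite (_ : (fun s => expR (a * s)) = expR \o ( *%R a)) //.
  apply: is_derive_eq.
  by rewrite /GRing.scale /=; ring.
case: (leP 0 t) => t0.
  suff : E t * expR (- L * t) <= 0.
    by rewrite pmulr_lle0 // expR_gt0.
  rewrite -[leRHS](mul0r (expR (- L * 0))) -{1}E0 -lerN2.
  apply: (@is_derive1_le _ (fun s => - (E s * expR (- L * s)))
    (fun s => (L * E s - E' s) * expR (- L * s))) t0 => s _.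
    have := dE s; have := eL s (- L) => ? ?; apply: is_derive_eq.
    by rewrite /GRing.scale /=; ring.
  rewrite mulr_ge0 ?expR_ge0 // subr_ge0.
  by apply: le_trans (bE s); exact: ler_norm.
suff : E t * expR (L * t) <= 0 by rewrite pmulr_lle0 // expR_gt0.
rewrite -[leRHS](mul0r (expR (L * 0))) -{1}E0.
apply: (@is_derive1_le _ (fun s => (E s * expR (L * s)))
    (fun s => (L * E s + E' s) * expR (L * s))) (ltW t0) => s _.
  have := dE s; have := eL s L => ? ?; apply: is_derive_eq.
  by rewrite /GRing.scale /=; ring.
rewrite mulr_ge0 ?expR_ge0 // -lerBlDr sub0r; apply: le_trans (bE s).
by rewrite -normrN ler_norm.
Qed.

(** * Discriminants and ovals *)

(* The pencil (al x + be) y^2 + (ga x^2 + de - h x) y + (ze x + et) (x + th)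
   contains the level curves for k = 2 and for k = 3. *)
Record biquad (R : Type) := Biquad
  { al : R; be : R; ga : R; de : R; ze : R; et : R; th : R }.

Section Discriminant.
Context {S : idomainType}.
Implicit Types (q : biquad S) (h : S).

Definition poly_B0 q : {poly S} := ga q *: 'X^2 + (de q)%:P.

Definition poly_4AC q : {poly S} :=
  4 *: ((al q *: 'X + (be q)%:P)
        * ((ze q *: 'X + (et q)%:P) * ('X + (th q)%:P))).

(** The level [h] is isolated inside the square, for its later elimination. The base ring is general
    so that [h] may be a real number or the indeterminate of R[h]. *)
Definition discP q h : {poly S} := (poly_B0 q - h *: 'X) ^+ 2 - poly_4AC q.

Lemma size_linear (a b : S) : (size (a *: 'X + b%:P)%R <= 2)%N.
Proof.
rewrite (leq_trans (size_polyD _ _)) // geq_max.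
rewrite (leq_trans (size_scale_leq _ _)) ?size_polyX //=.
by rewrite (leq_trans (size_polyC_leq1 _)).
Qed.

Lemma size_poly_4AC q : (size (poly_4AC q) <= 4)%N.
Proof.
rewrite (leq_trans (size_scale_leq _ _)) //.
rewrite (leq_trans (size_polyMleq _ _)) // -subn1 leq_subLR.
apply: (@leq_trans (2 + 3)); last by [].
apply: leq_add; first exact: size_linear.
rewrite (leq_trans (size_polyMleq _ _)) // -subn1 leq_subLR.
apply: (@leq_trans (2 + 2)); last by [].
apply: leq_add; first exact: size_linear.
by have := size_linear 1 (th q); rewrite scale1r.
Qed.

Lemma size_lead_polyDl (p r : {poly S}) (n : nat) (c : S) :
  size p = n -> lead_coef p = c -> (size r < n)%N ->
  size (p + r) = n /\ lead_coef (p + r) = c.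
Proof. by move=> <- <- rp; rewrite size_polyDl ?lead_coefDl. Qed.

Lemma size_lead_quadratic (c b d : S) : c != 0 ->
  size (c *: 'X^2 + (b *: 'X + d%:P)) = 3%N /\
  lead_coef (c *: 'X^2 + (b *: 'X + d%:P)) = c.
Proof.
move=> c0; apply: size_lead_polyDl; last exact: size_linear.
  by rewrite size_scale // size_polyXn.
by rewrite lead_coefZ lead_coefXn mulr1.
Qed.

Lemma size_lead_sqr (p : {poly S}) (c : S) :
  size p = 3%N /\ lead_coef p = c ->
  size (p ^+ 2) = 5%N /\ lead_coef (p ^+ 2) = c ^+ 2.
Proof.
move=> [sp lp]; have p0 : p != 0 by rewrite -size_poly_eq0 sp.
by rewrite size_mul // sp lead_coefM lp.
Qed.

(** Only the square reaches degree 4, the term 4AC having degree at most 3; so the leading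
    coefficient does not involve [h]. *)
Lemma size_discP q h : ga q != 0 ->
  size (discP q h) = 5%N /\ lead_coef (discP q h) = ga q ^+ 2.
Proof.
move=> g0; rewrite /discP /poly_B0 -addrA [_%:P - _]addrC -scaleNr.
have [sp lp] := size_lead_sqr (size_lead_quadratic (- h) (de q) g0).
by apply: size_lead_polyDl; rewrite // size_polyN ltnS size_poly_4AC.
Qed.
End Discriminant.

(** * Real roots of the discriminant *)

Section Biquad.
Context {R : realType}.
Implicit Types (q : biquad R) (h x y : R).

Definition quadA q x := al q * x + be q.
Definition quadB q h x := ga q * x ^+ 2 + de q - h * x.
Definition quadC q x := (ze q * x + et q) * (x + th q).
Definition quadP q h x y := quadA q x * y ^+ 2 + quadB q h x * y + quadC q x.
(** [quadPx] and [quadPy] are the partial derivatives of [quadP]. *)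
Definition quadPx q h x y :=
  al q * y ^+ 2 + (2 * ga q * x - h) * y
  + (ze q * (x + th q) + (ze q * x + et q)).
Definition quadPy q h x y := 2 * quadA q x * y + quadB q h x.

(* The last inequality is D(0) >= 0, which forces D to have a root on the left
   of the oval. *)
Definition positive_biquad q : Prop :=
  [/\ [/\ 0 < al q, 0 < be q, 0 < ga q & 0 < de q],
      [/\ 0 < ze q, 0 < et q & 0 < th q]
    & 4 * be q * et q * th q <= de q ^+ 2].

Lemma horner_discP q h x :
  (discP q h).[x] = quadB q h x ^+ 2 - 4 * quadA q x * quadC q x.
Proof.
rewrite /discP /poly_B0 /poly_4AC.
rewrite !(hornerD, hornerN, hornerM, hornerZ, hornerC, hornerX, hornerXn,
  horner_exp).
by rewrite /quadA /quadB /quadC; ring.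
Qed.

Lemma horner_deriv_discP q h x :
  (discP q h)^`().[x] =
  2 * quadB q h x * (2 * ga q * x - h)
  - 4 * (al q * quadC q x
         + quadA q x * (ze q * (x + th q) + (ze q * x + et q))).
Proof.
rewrite /discP /poly_B0 /poly_4AC.
rewrite !(derivD, derivN, derivM, derivZ, derivX, derivXn, derivC,
  deriv_exp) /=.
rewrite !(hornerD, hornerN, hornerM, hornerZ, hornerC, hornerX, hornerXn,
  horner_exp, hornerMn) /quadA /quadB /quadC.
ring.
Qed.

(** Completion of the square in y. On the curve P = 0 it gives D = (dP/dy)^2, that is x' = sqrt D(x)
    up to sign along the flow. *)
Lemma discP_quadPy q h x y :
  (discP q h).[x] = quadPy q h x y ^+ 2 - 4 * quadA q x * quadP q h x y.
Proof. by rewrite horner_discP /quadP /quadPy; ring. Qed.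

(* D is nonnegative at 0, negative at both roots of quadB, positive at x0
   between them, and has a positive leading coefficient: this makes four simple
   real roots. *)
Lemma quad_oval q h x0 :
  positive_biquad q -> 0 < x0 -> quadB q h x0 < 0 -> 0 < (discP q h).[x0] ->
  exists e1 l r e4 : R,
    [/\ 0 <= e1, e1 < l, l < r & r < e4] /\
    [/\ l < x0 < r,
        discP q h = ga q ^+ 2 *: (('X - e1%:P) * ('X - l%:P)
                                  * ('X - r%:P) * ('X - e4%:P)),
        forall x, l <= x <= r -> quadB q h x < 0
      & forall x, 0 < x -> quadB q h x < 0 -> 0 <= (discP q h).[x] ->
          l <= x <= r].
Proof.
move=> [[al0 be0 ga0 de0] [ze0 et0 th0] d0] x00 Bx0 Dx0.
have A0 x : 0 <= x -> 0 < quadA q x.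
  by move=> x_; rewrite /quadA ltr_wpDl // mulr_ge0 // ltW.
have C0 x : 0 <= x -> 0 < quadC q x.
  by move=> x_; rewrite /quadC mulr_gt0 // ltr_wpDl // mulr_ge0 // ltW.
have h0 : 0 < h.
  have : 0 < h * x0.
    move: Bx0; rewrite /quadB subr_lt0; apply: le_lt_trans.
    by rewrite addr_ge0 ?ltW // mulr_gt0 // exprn_gt0.
  by rewrite pmulr_lgt0.
pose b : {poly R} := ga q *: 'X^2 + (de q)%:P - h *: 'X.
have bE x : b.[x] = quadB q h x.
  by rewrite /b !(hornerD, hornerN, hornerZ, hornerC, hornerX, hornerXn).
have [xm /andP[xm0 xmx0] xmB] : exists2 x, 0 < x < x0 & quadB q h x = 0.
  have [|x /andP[x_ xx0] /rootP xB] := @poly_ivt _ (- b) 0 x0 (ltW x00).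
    rewrite !hornerN !bE oppr_le0 oppr_ge0 (ltW Bx0) andbT.
    by rewrite /quadB expr0n mulr0 add0r mulr0 subr0 ltW.
  move: xB => /eqP; rewrite hornerN bE oppr_eq0 => /eqP xB.
  exists x => //; apply/andP; split; rewrite lt_neqAle ?x_ ?xx0 andbT.
    apply/eqP => e; move: xB; rewrite -e /quadB expr0n /= !mulr0 add0r subr0.
    by move=> d1; move: de0; rewrite d1 ltxx.
  by apply/eqP => e; move: Bx0; rewrite -e xB ltxx.
have [xp x0xp xpB] : exists2 x, x0 < x & quadB q h x = 0.
  (* Chosen so that [quadB q h M] collapses to ga x0 M + de, which is positive. *)
  pose M := x0 + h / ga q.
  have x0M : x0 < M by rewrite ltrDl divr_gt0.
  have BM : 0 < quadB q h M.
    have -> : quadB q h M = ga q * x0 * M + de q.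
      by rewrite /quadB /M; field; rewrite gt_eqF.
    by rewrite addr_gt0 // !mulr_gt0 // (lt_trans x00).
  have [|x /andP[x_ _] /rootP] := @poly_ivt _ b x0 M (ltW x0M).
    by rewrite !bE !ltW.
  rewrite bE => xB; exists x => //.
  by rewrite lt_neqAle x_ andbT; apply/eqP => e; move: Bx0; rewrite e xB ltxx.
have Bfact x : quadB q h x = ga q * (x - xm) * (x - xp).
  have hE : h = ga q * (xm + xp).
    apply/eqP; rewrite -subr_eq0; apply/eqP.
    have : (xp - xm) * (h - ga q * (xm + xp)) = 0.
      rewrite -[RHS](subrr 0) -{1}xmB -{1}xpB /quadB; ring.
    by move/eqP; rewrite mulf_eq0 subr_eq0 gt_eqF ?(lt_trans xmx0) // => /eqP.
  have dE : de q = ga q * xm * xp.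
    by move: xmB; rewrite /quadB hE => e; rewrite -[LHS]subr0 -e; ring.
  by rewrite /quadB dE hE; ring.
set D := discP q h.
have DE x : D.[x] = quadB q h x ^+ 2 - 4 * quadA q x * quadC q x.
  exact: horner_discP.
have Dneg x : 0 <= x -> quadB q h x = 0 -> D.[x] < 0.
  move=> x_ B0; rewrite DE B0 expr0n /= sub0r oppr_lt0.
  by rewrite mulr_gt0 ?C0 // mulr_gt0 ?A0.
have Dm := Dneg _ (ltW xm0) xmB.
have Dp := Dneg _ (ltW (lt_trans x00 x0xp)) xpB.
have D0 : 0 <= D.[0].
  rewrite DE /quadA /quadB /quadC expr0n /= !mulr0 !add0r subr0 subr_ge0.
  by rewrite !mulrA.
have ivt (p : {poly R}) a c : a < c -> p.[a] <= 0 -> 0 < p.[c] ->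
    exists2 x, a <= x < c & p.[x] = 0.
  move=> ac pa pc.
  have [|x /andP[ax xc] /rootP e] := @poly_ivt _ p a c (ltW ac).
    by rewrite pa ltW.
  exists x => //; rewrite ax lt_neqAle xc andbT; apply/eqP => xe.
  by move: pc; rewrite -xe e ltxx.
have [e1 /andP[e10 e1m] De1] : exists2 x, 0 <= x < xm & D.[x] = 0.
  have [||x xi /eqP] := ivt (- D) 0 xm xm0;
    rewrite ?hornerN ?oppr_le0 ?oppr_gt0 //.
  by rewrite oppr_eq0 => /eqP; exists x.
have [l /andP[ml lx0] Dl] : exists2 x, xm < x < x0 & D.[x] = 0.
  have [x /andP[xi xlt] e] := ivt D xm x0 xmx0 (ltW Dm) Dx0.
  exists x => //; rewrite xlt lt_neqAle xi !andbT; apply/eqP => xe.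
  by move: Dm; rewrite xe e ltxx.
have [r /andP[x0r rp] Dr] : exists2 x, x0 < x < xp & D.[x] = 0.
  have [||x /andP[xi xlt] /eqP] := ivt (- D) x0 xp x0xp;
    rewrite ?hornerN ?oppr_le0 ?oppr_gt0 // ?ltW //.
  rewrite oppr_eq0 => /eqP e; exists x => //.
  rewrite lt_neqAle xi xlt !andbT; apply/eqP => xe.
  by move: Dx0; rewrite xe e ltxx.
have [sD lD] := size_discP h (lt0r_neq0 ga0).
(* Three distinct roots leave a linear cofactor, whose root is the fourth one, [e4]. *)
have [Q QE] : exists Q, D = Q * \prod_(z <- [:: e1; l; r]) ('X - z%:P).
  apply: uniq_roots_prod_XsubC.
    by rewrite /= !rootE De1 Dl Dr eqxx.
  rewrite uniq_rootsE /= !inE !negb_or !andbT !lt_eqF //; lra.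
have prodN : \prod_(z <- [:: e1; l; r]) ('X - z%:P) != 0 :> {poly R}.
  by rewrite monic_neq0 // monic_prod_XsubC.
have sQ : size Q = 2%N.
  have Q0 : Q != 0.
    by apply/eqP => Q0; move: sD; rewrite -/D QE Q0 mul0r size_poly0.
  have := sD; rewrite -/D QE size_mul // size_prod_XsubC /= addnC => -[].
  by case: (size Q) => // -[|[]].
have lQ : lead_coef Q = ga q ^+ 2.
  rewrite -lD -/D QE lead_coefM (monicP (monic_prod_XsubC _ _ _)) mulr1 //.
have QX : exists e4, Q = ga q ^+ 2 *: ('X - e4%:P).
  exists (- Q`_0 / ga q ^+ 2); apply/polyP => i.
  rewrite coefZ coefB coefX coefC.
  case: i => [|[|i]] /=.
  - by rewrite sub0r mulNr opprK mulrCA divff ?mulr1 // expf_neq0 // gt_eqF.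
  - by rewrite subr0 mulr1 -lQ lead_coefE sQ.
  - by rewrite subr0 mulr0 nth_default // sQ.
have [e4 Q4] := QX.
have Dfact : D = ga q ^+ 2 *: (('X - e1%:P) * ('X - l%:P) * ('X - r%:P)
                               * ('X - e4%:P)).
  by rewrite QE Q4 !big_cons big_nil -scalerAl; congr (_ *: _); ring.
have DxE x : D.[x] = ga q ^+ 2 * ((x - e1) * (x - l) * (x - r) * (x - e4)).
  by rewrite Dfact hornerZ !hornerM !hornerXsubC.
have g2 : 0 < ga q ^+ 2 by rewrite exprn_gt0.
(* At [xp] the first three factors are positive and D is negative, so the last factor is
   negative. *)
have re4 : xp < e4.
  move: Dp; rewrite DxE pmulr_rlt0 // pmulr_rlt0 ?subr_lt0 //.
  by rewrite !mulr_gt0 // subr_gt0; lra.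
exists e1, l, r, e4; split; first by split => //; lra.
split=> //; first by rewrite lx0 x0r.
  move=> x /andP[lx xr]; rewrite Bfact -mulrA pmulr_rlt0 //.
  by rewrite pmulr_rlt0 ?subr_lt0 ?subr_gt0; lra.
move=> x xpos; rewrite Bfact -mulrA pmulr_rlt0 // => Bx.
have [xmx xxp] : xm < x /\ x < xp.
  have [xm_x|x_xm] := ltP xm x.
    by move: Bx; rewrite pmulr_rlt0 ?subr_gt0 // subr_lt0.
  move: Bx; rewrite ltNge mulr_le0 //; lra.
rewrite DxE pmulr_rge0 //.
(* Between [xm] and [xp] the outer pair (x - e1)(e4 - x) is positive, so the inner pair carries the
   sign of D. *)
have -> : (x - e1) * (x - l) * (x - r) * (x - e4)
   = ((x - e1) * (e4 - x)) * ((x - l) * (r - x)) by ring.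
rewrite pmulr_rge0; last by rewrite mulr_gt0 // subr_gt0; lra.
move=> H; have [lx|xl] := leP l x; have [xr|rx] := leP x r => //.
- move: H; rewrite leNgt pmulr_rlt0 ?subr_lt0 ?subr_gt0 ?rx //; lra.
- move: H; rewrite leNgt pmulr_llt0 ?subr_lt0 ?subr_gt0 ?xl //; lra.
- lra.
Qed.
End Biquad.

(** * The flow on an oval *)

(** The bound and the Lipschitz constant go through the induction together, since the Lipschitz
    estimate for p X + c needs the bound on p. *)
Lemma poly_lipschitz (R : realType) (p : {poly R}) (M : R) :
  exists K : R, 0 <= K /\ forall x z : R, `|x| <= M -> `|z| <= M ->
    `|p.[x]| <= K /\ `|p.[x] - p.[z]| <= K * `|x - z|.
Proof.
elim/poly_ind: p => [|p c [K [K0 HK]]].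
  by exists 0; split=> // x z _ _; rewrite !horner0 subrr normr0 mul0r.
exists (K * `|M| + `|c| + K); split; first by rewrite !addr_ge0 // mulr_ge0.
move=> x z xM zM; have [p1 p2] := HK x z xM zM.
have zM' : `|z| <= `|M| by apply: le_trans zM (ler_norm _).
have xM' : `|x| <= `|M| by apply: le_trans xM (ler_norm _).
rewrite !(hornerD, hornerM, hornerX, hornerC); split.
  apply: le_trans (ler_normD _ _) _; rewrite normrM.
  have : `|p.[x]| * `|x| <= K * `|M| by rewrite ler_pM.
  lra.
have -> : p.[x] * x + c - (p.[z] * z + c)
    = p.[x] * (x - z) + z * (p.[x] - p.[z]).
  by ring.
apply: le_trans (ler_normD _ _) _; rewrite !normrM.
have h1 : `|p.[x]| * `|x - z| <= K * `|x - z| by rewrite ler_wpM2r.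
have h2 : `|z| * `|p.[x] - p.[z]| <= `|M| * (K * `|x - z|) by rewrite ler_pM.
have h3 : 0 <= `|c| * `|x - z| by rewrite mulr_ge0.
by nra.
Qed.

Lemma sqr_sum1_angle (R : realType) (c s : R) :
  c ^+ 2 + s ^+ 2 = 1 -> exists t, cos t = c /\ sin t = s.
Proof.
move=> cs1.
have c1 : -1 <= c <= 1.
  have : c ^+ 2 <= 1 by rewrite -cs1 lerDl sqr_ge0.
  by move=> c1; apply/andP; split; nra.
have ss : s ^+ 2 = sin (acos c) ^+ 2.
  by rewrite sin2cos2 acosK ?in_itv //= -cs1; ring.
move/eqP: ss; rewrite eqf_sqr => /orP[] /eqP ->.
  by exists (acos c); rewrite acosK ?in_itv.
by exists (- acos c); rewrite cosN sinN acosK ?in_itv.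
Qed.

Section Flow.
Context {R : realType}.
Implicit Types (q : biquad R) (h : R) (u v : R -> R).

(* On the level h, these are the solutions of the Hamiltonian system of
   x y (V - h). *)
Definition flow q h u v : Prop := forall t : R,
  [/\ is_derive t 1 u (quadPy q h (u t) (v t)),
      is_derive t 1 v (- quadPx q h (u t) (v t)),
      0 < u t, 0 < v t & quadP q h (u t) (v t) = 0].

Lemma flow_shift q h u v (s : R) :
  flow q h u v -> flow q h (fun t => u (t + s)) (fun t => v (t + s)).
Proof.
move=> uv t; have [du dv u0 v0 P0] := uv (t + s); split=> //.
  rewrite (_ : (fun t => u (t + s)) = u \o (+%R^~ s)) //.
  by apply: is_derive_eq; rewrite /GRing.scale /=; ring.
rewrite (_ : (fun t => v (t + s)) = v \o (+%R^~ s)) //.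
by apply: is_derive_eq; rewrite /GRing.scale /=; ring.
Qed.

(** With A, C and y positive, A y^2 + B y + C = 0 forces B < 0; then ga x^2 < h x. *)
Lemma quadP_bound q h x y : positive_biquad q ->
  0 < x -> 0 < y -> quadP q h x y = 0 -> quadB q h x < 0 /\ x < h / ga q.
Proof.
move=> [[al0 be0 ga0 de0] [ze0 et0 th0] _] x0 y0 P0.
have A0 : 0 < quadA q x by rewrite addr_gt0 // mulr_gt0.
have C0 : 0 < quadC q x by rewrite mulr_gt0 // addr_gt0 // mulr_gt0.
have B0 : quadB q h x < 0.
  rewrite -(pmulr_llt0 _ y0).
  have : 0 < quadA q x * y ^+ 2 by rewrite mulr_gt0 // exprn_gt0.
  by move: P0; rewrite /quadP; lra.
split=> //; rewrite ltr_pdivlMr // -subr_lt0 -(pmulr_llt0 _ x0).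
by move: B0; rewrite /quadB; nra.
Qed.

(** Differentiating u'^2 = D(u) suggests u'' = D'(u)/2. This equation no longer mentions [v]. *)
Lemma flow_speed q h u v (t : R) : flow q h u v ->
  is_derive t 1 (fun t => quadPy q h (u t) (v t)) ((discP q h)^`().[u t] / 2).
Proof.
move=> uv; have [du dv u0 v0 P0] := uv t.
rewrite /quadPy /quadA /quadB; apply: is_derive_eq.
rewrite horner_deriv_discP /GRing.scale /=.
have -> : quadC q (u t) = - (quadA q (u t) * v t ^+ 2 + quadB q h (u t) * v t).
  by move: P0; rewrite /quadP; lra.
by rewrite /quadPy /quadPx /quadA /quadB; field.
Qed.

(** In the variables u and w = dP/dy the system is u' = w, w' = D'(u)/2, which is Lipschitz because
    [u] stays in a bounded interval. Then [v] is recovered from [w], as A does not vanish. *)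
Lemma flow_unique q h u v u' v' :
  positive_biquad q -> flow q h u v -> flow q h u' v' ->
  u 0 = u' 0 -> v 0 = v' 0 -> forall t, u t = u' t /\ v t = v' t.
Proof.
move=> qpos uv uv' u00 v00.
pose w t := quadPy q h (u t) (v t); pose w' t := quadPy q h (u' t) (v' t).
have [K [K0 HK]] := poly_lipschitz (discP q h)^`() (h / ga q).
have bd (a b : R -> R) t : flow q h a b -> `|a t| <= h / ga q.
  move=> ab; have [_ _ a0 b0 P0] := ab t.
  by have [_ /ltW] := quadP_bound qpos a0 b0 P0; rewrite gtr0_norm.
have du (t : R) : is_derive t 1 (u - u') (w t - w' t).
  by have [? _ _ _ _] := uv t; have [? _ _ _ _] := uv' t; exact: is_deriveB.
have dw (t : R) : is_derive t 1 (w - w')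
    ((discP q h)^`().[u t] / 2 - (discP q h)^`().[u' t] / 2).
  by apply: is_deriveB; exact: flow_speed.
have H := gronwall_zero (K := K + 1) du dw.
have {H} : forall t, (u - u') t = 0 /\ (w - w') t = 0.
  apply: H => [t|t||].
  - rewrite -[w t - w' t]/((w - w') t).
    have := mulr_ge0 K0 (normr_ge0 ((u - u') t)).
    have := mulr_ge0 K0 (normr_ge0 ((w - w') t)).
    by have := normr_ge0 ((u - u') t); rewrite mulrDl mulrDr; lra.
  - have [_ HL] := HK (u t) (u' t) (bd _ _ _ uv) (bd _ _ _ uv').
    rewrite -mulrBl normrM (@gtr0_norm _ (2^-1)) ?invr_gt0 //.
    apply: (@le_trans _ _ (K * `|u t - u' t|)).
      apply: le_trans HL.
      by rewrite ler_piMr // invf_le1 // ler1n.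
    rewrite -[u t - u' t]/((u - u') t).
    have := mulr_ge0 K0 (normr_ge0 ((w - w') t)).
    have := normr_ge0 ((w - w') t).
    by have := normr_ge0 ((u - u') t); rewrite mulrDl mulrDr; lra.
  - by rewrite -[(u - u') 0]/(u 0 - u' 0) u00 subrr.
  - by rewrite -[(w - w') 0]/(w 0 - w' 0) /w /w' u00 v00 subrr.
move=> H t; have [/eqP] := H t.
rewrite -[(u - u') t]/(u t - u' t) subr_eq0 => /eqP ut /eqP.
rewrite -[(w - w') t]/(w t - w' t) subr_eq0 /w /w' /quadPy ut => /eqP wt.
split=> //; have [_ _ a0 _ _] := uv' t.
have A0 : 2 * quadA q (u' t) != 0.
  case: qpos => [[al0 be0 _ _] _ _].
  by rewrite gt_eqF // mulr_gt0 // addr_gt0 // mulr_gt0.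
by move: wt => /addIr /(mulfI A0).
Qed.
End Flow.

(* The oval is parametrised by x = m - rho cos t, which removes the square root
   singularities of dx / sqrt D(x) at both ends; the time is then the integral
   of dt / sqrt (ga^2 (x - e1) (e4 - x)). *)
Lemma oval_flow (R : realType) (q : biquad R) (h e1 l r e4 : R) :
  positive_biquad q -> 0 <= e1 -> e1 < l -> l < r -> r < e4 ->
  discP q h = ga q ^+ 2 *: (('X - e1%:P) * ('X - l%:P)
                            * ('X - r%:P) * ('X - e4%:P)) ->
  (forall x, l <= x <= r -> quadB q h x < 0) ->
  (forall x, 0 < x -> quadB q h x < 0 -> 0 <= (discP q h).[x] -> l <= x <= r) ->
  exists u v : R -> R,
    [/\ flow q h u v,
        exists T, [/\ T != 0, u T = u 0 & v T = v 0]
      & forall x y, 0 < x -> 0 < y -> quadP q h x y = 0 ->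
          exists t, u t = x /\ v t = y].
Proof.
move=> qpos e10 e1l lr re4 DE Bneg Dlr.
have [[al0 be0 ga0 de0] [ze0 et0 th0] _] := qpos.
have A0 x : 0 <= x -> 0 < quadA q x.
  by move=> x_; rewrite /quadA ltr_wpDl // mulr_ge0 // ltW.
have C0 x : 0 <= x -> 0 < quadC q x.
  by move=> x_; rewrite /quadC mulr_gt0 // ltr_wpDl // mulr_ge0 // ltW.
have g2 : 0 < ga q ^+ 2 by rewrite exprn_gt0.
pose m := (l + r) / 2; pose rho := (r - l) / 2.
have rho0 : 0 < rho by rewrite divr_gt0 // subr_gt0.
(* D(x) = (x - l)(r - x) k(x), with k positive on [l, r]. *)
pose k x : R := ga q ^+ 2 * ((x - e1) * (e4 - x)).
pose X a : R := m - rho * cos a.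
have Xlr a : l <= X a <= r.
  have c1 : rho * cos a <= rho by rewrite ger_pMr // cos_le1.
  have c2 : - rho <= rho * cos a by rewrite -mulrN1 ler_pM2l // cos_geN1.
  by move: c1 c2; rewrite /X /m /rho; lra.
have Dk x : (discP q h).[x] = (x - l) * (r - x) * k x.
  by rewrite DE hornerZ !hornerM !hornerXsubC /k; ring.
have dDk x : (discP q h)^`().[x] = (l + r - 2 * x) * k x
    + (x - l) * (r - x) * (ga q ^+ 2 * (e1 + e4 - 2 * x)).
  rewrite DE derivZ !derivM !derivXsubC !(hornerZ, hornerD, hornerM,
    hornerN, hornerX, hornerC) /k; ring.
pose cc := ga q ^+ 2 * ((l - e1) * (e4 - r)).
pose CC := ga q ^+ 2 * ((r - e1) * (e4 - l)).
have cc0 : 0 < cc by rewrite /cc !mulr_gt0 // subr_gt0.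
have kb x : l <= x <= r -> cc <= k x <= CC.
  move=> /andP[lx xr]; rewrite /cc /CC /k !(ler_pM2l g2).
  by rewrite !ler_pM //; lra.
have k0 x : l <= x <= r -> 0 < k x.
  by move=> /kb /andP[+ _]; exact: lt_le_trans.
pose f a := Num.sqrt (k (X a)).
have dk (x : R) : is_derive x 1 k (ga q ^+ 2 * (e1 + e4 - 2 * x)).
  by rewrite /k; apply: is_derive_eq; rewrite /GRing.scale /=; ring.
have fC : continuous f.
  move=> a; have ? : is_derive a 1 X (rho * sin a).
    by rewrite /X; apply: is_derive_eq; rewrite /GRing.scale /=; ring.
  have dka := dk (X a); have dkX := is_derive1_comp dka _.
  have ? := is_derive1_sqrt (k0 _ (Xlr a)).
  exact: is_derive1_continuous (@is_derive1_comp _ Num.sqrt (k \o X) _ _ _ _ _).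
have [||] := @scalar_autonomous_ode R f (Num.sqrt cc) (Num.sqrt CC) fC.
- by rewrite sqrtr_gt0.
- move=> a; have /andP[k1 k2] := kb _ (Xlr a).
  by rewrite /f !ler_wsqrtr.
move=> phi [dphi surj].
pose u t := m - rho * (cos \o phi) t.
pose w t := (Num.sqrt \o (k \o u)) t.
(* [s] is the derivative of [u], hence the intended value of dP/dy, and [v] is the solution y of
   dP/dy = s. *)
pose s t := rho * (sin \o phi) t * w t.
pose v t := (s t - quadB q h (u t)) / (2 * quadA q (u t)).
have ulr t : l <= u t <= r by exact: Xlr.
have u0 t : 0 < u t.
  by have /andP[+ _] := ulr t; apply: lt_le_trans; rewrite (le_lt_trans e10).
have w0 t : 0 < w t by rewrite /w /= sqrtr_gt0 k0.
have w2 t : w t ^+ 2 = k (u t) by rewrite /w /= sqr_sqrtr // ltW // k0.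
have dc (t : R) : is_derive t 1 (cos \o phi) (- sin (phi t) * w t).
  by have := dphi t => ?; apply: is_derive1_comp.
have ds (t : R) : is_derive t 1 (sin \o phi) (cos (phi t) * w t).
  by have := dphi t => ?; apply: is_derive1_comp.
have du (t : R) : is_derive t 1 u (s t).
  have := dc t => ?; rewrite /u; apply: is_derive_eq.
  by rewrite /s /GRing.scale /=; ring.
have dku (t : R) : is_derive t 1 (k \o u)
    (ga q ^+ 2 * (e1 + e4 - 2 * u t) * s t).
  have := du t; have := dk (u t) => ? ?.
  exact: is_derive1_comp.
have dw (t : R) : is_derive t 1 w
    ((2 * w t)^-1 * (ga q ^+ 2 * (e1 + e4 - 2 * u t) * s t)).
  have := dku t => ?; have ? := is_derive1_sqrt (k0 _ (ulr t)).
  exact: (@is_derive1_comp _ Num.sqrt (k \o u)).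
have sc1 t : cos (phi t) ^+ 2 = 1 - sin (phi t) ^+ 2.
  by rewrite -(cos2Dsin2 (phi t)); ring.
have dsp (t : R) : is_derive t 1 s ((discP q h)^`().[u t] / 2).
  have := ds t; have := dw t => ? ?; rewrite /s; apply: is_derive_eq.
  rewrite dDk -w2 /GRing.scale /= -/(s t).
  have -> : (u t - l) * (r - u t) = rho ^+ 2 * (1 - cos (phi t) ^+ 2).
    by rewrite /u /rho /m /=; field.
  rewrite sc1 /s /=.
  have -> : l + r - 2 * u t = 2 * rho * cos (phi t).
    by rewrite /u /rho /m /=; field.
  by field; rewrite gt_eqF.
have sE t : quadPy q h (u t) (v t) = s t.
  rewrite /quadPy /v; have := A0 (u t) (ltW (u0 t)) => A_.
  by field; rewrite gt_eqF.
have s2 t : s t ^+ 2 = (discP q h).[u t].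
  rewrite Dk -w2 /s /=.
  have -> : (u t - l) * (r - u t) = rho ^+ 2 * (1 - cos (phi t) ^+ 2).
    by rewrite /u /rho /m /=; field.
  by rewrite sc1; ring.
have P0 t : quadP q h (u t) (v t) = 0.
  have := discP_quadPy q h (u t) (v t); rewrite sE s2.
  have A_ := A0 (u t) (ltW (u0 t)).
  move/eqP; rewrite -subr_eq0 opprB addrC subrK !mulf_eq0.
  by rewrite (gt_eqF A_) pnatr_eq0 /= => /eqP.
have fl : flow q h u v.
  move=> t; have A_ := A0 (u t) (ltW (u0 t)).
  have C_ := C0 (u t) (ltW (u0 t)).
  have B_ := Bneg (u t) (ulr t).
  split; [by rewrite sE; exact: du| |exact: u0| |exact: P0].
  - have dut := du t; have dst := dsp t.
    have A2 : 2 * quadA q (u t) != 0 by rewrite gt_eqF // mulr_gt0.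
    have dB : is_derive t 1 (fun t => quadB q h (u t))
        ((2 * ga q * u t - h) * s t).
      by rewrite /quadB; apply: is_derive_eq; rewrite /GRing.scale /=; ring.
    have dA : is_derive t 1 (fun t => 2 * quadA q (u t)) (2 * al q * s t).
      by rewrite /quadA; apply: is_derive_eq; rewrite /GRing.scale /=; ring.
    have dV := @is_deriveV _ (fun t => 2 * quadA q (u t)) _ _ _ A2 dA.
    rewrite /v; apply: is_derive_eq.
    rewrite horner_deriv_discP /quadPx /GRing.scale /= /v.
    have -> : quadC q (u t) = (quadB q h (u t) ^+ 2 - s t ^+ 2)
        / (4 * quadA q (u t)).
      by rewrite s2 horner_discP; field; rewrite gt_eqF.
    by field; rewrite gt_eqF.
  (* If s <= B < 0 then s^2 >= B^2, against s^2 = B^2 - 4AC with AC > 0. *)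
  - rewrite /v divr_gt0 ?mulr_gt0 // subr_gt0 ltNge; apply/negP => sB.
    have := s2 t; rewrite horner_discP => s2t.
    have : 0 < quadA q (u t) * quadC q (u t) by rewrite mulr_gt0.
    have : 0 <= (quadB q h (u t) - s t) * (- quadB q h (u t) - s t).
      by rewrite mulr_ge0; lra.
    by nra.
(* Time is shifted to start at angle 0; the period is the time taken to reach the angle 2 pi. *)
have [t0 pt0] := surj 0; have [t1 pt1] := surj (pi *+ 2).
exists (fun t => u (t + t0)), (fun t => v (t + t0)); split.
- exact: flow_shift.
- exists (t1 - t0); rewrite subrK add0r.
  have ue : u t1 = u t0 by rewrite /u /= pt0 pt1 cos0 cos2pi.
  have se : s t1 = s t0 by rewrite /s /= pt0 pt1 sin0 sin2pi !mulr0 !mul0r.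
  split=> //; last by rewrite /v ue se.
  rewrite subr_eq0; apply/eqP => e; move: pt1; rewrite e pt0 => /esym/eqP.
  by rewrite mulrn_eq0 /= gt_eqF // pi_gt0.
move=> x y x0 y0 Pxy.
have [Bx _] := quadP_bound qpos x0 y0 Pxy.
have Dx : (discP q h).[x] = quadPy q h x y ^+ 2.
  by rewrite (discP_quadPy q h x y) Pxy mulr0 subr0.
have xlr : l <= x <= r by apply: Dlr => //; rewrite Dx sqr_ge0.
have kx := k0 _ xlr; have kx' := ltW kx.
have sk : Num.sqrt (k x) != 0 by rewrite gt_eqF // sqrtr_gt0.
(* A point of the curve has (dP/dy)^2 = D(x) = (rho^2 - (x - m)^2) k(x), so these two numbers are a
   cosine and a sine. *)
have [|a [ca sa]] := @sqr_sum1_angle R ((m - x) / rho)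
    (quadPy q h x y / (rho * Num.sqrt (k x))).
  rewrite !expr_div_n exprMn sqr_sqrtr // -Dx Dk /rho /m.
  by field; rewrite (gt_eqF kx) subr_eq0 gt_eqF.
have [t pt] := surj a; exists (t - t0); rewrite subrK.
have ut : u t = x by rewrite /u /= pt ca; field; rewrite gt_eqF.
split=> //.
have st : s t = quadPy q h x y.
  rewrite /s /w /= pt ut sa; field.
  by rewrite sk gt_eqF.
rewrite /v st ut /quadPy; field.
by rewrite gt_eqF // A0 // ltW.
Qed.

(** * Dynamics of the Lyness maps *)

(** Pigeonhole on the fractional parts of i tau / T yields a step d = n tau - q T with |d| < e. It
    is nonzero in the nonperiodic case, and its multiples come within e of any target. *)
Lemma rotation_dichotomy (R : realType) (T tau : R) : T != 0 ->
  (exists (p : nat) (q : int), (0 < p)%N /\ p%:R * tau = q%:~R * T) \/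
  (forall s e : R, 0 < e ->
     exists (n : nat) (q : int), `|n%:R * tau - q%:~R * T - s| < e).
Proof.
move=> T0.
have [|nper] := pselect (exists (p : nat) (q : int),
  (0 < p)%N /\ p%:R * tau = q%:~R * T); [by left|right=> s e e0].
pose fr (i : nat) : R := i%:R * tau / T - (Num.floor (i%:R * tau / T))%:~R.
have fr01 i : 0 <= fr i < 1.
  have := floor_itv (i%:R * tau / T); rewrite /fr intrD.
  by move=> /andP[? ?]; apply/andP; split; lra.
pose N := (Num.truncn (`|T| / e)).+1.
have N0 : (0 : R) < N%:R by rewrite ltr0n.
have NT : `|T| < N%:R * e by rewrite -ltr_pdivrMr // truncnS_gt.
have bN i : (Num.truncn (N%:R * fr i) < N)%N.
  have /andP[f0 f1] := fr01 i.
  rewrite truncn_lt_nat ?mulr_ge0 ?ler0n // gtr_pMr //.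
pose b (i : 'I_N.+1) : 'I_N := Ordinal (bN i).
have [i [j [ij bij]]] : exists i j : 'I_N.+1, (i < j)%N /\ b i = b j.
  have : ~ injective b by move=> /leq_card; rewrite !card_ord ltnn.
  move=> nb; apply: contrapT => H; apply: nb => i j bij; apply/val_inj => /=.
  case: (ltngtP i j) => // ij; exfalso; apply: H; first by exists i, j.
  by exists j, i.
have frij : `|fr j - fr i| * N%:R < 1.
  move: bij => /(congr1 val) /= bij.
  have /andP[fi0 _] := fr01 i; have /andP[fj0 _] := fr01 j.
  have /andP[i1 i2] := truncn_itv (mulr_ge0 (ltW N0) fi0).
  have /andP[j1 j2] := truncn_itv (mulr_ge0 (ltW N0) fj0).
  rewrite -[X in _ * X < _](ger0_norm (ltW N0)) -normrM ltr_norml.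
  move: i1 i2 j1 j2; rewrite bij -natr1; move: (_%:R : R) => z.
  by move=> ? ? ? ?; apply/andP; split; lra.
pose q0 : int := Num.floor (j%:R * tau / T) - Num.floor (i%:R * tau / T).
pose d := (j - i)%:R * tau - q0%:~R * T.
have dE : d = (fr j - fr i) * T.
  rewrite /d /fr /q0 natrB ?(ltnW ij) // rmorphB /=; field => //.
have d0 : d != 0.
  apply/eqP => d0; apply: nper; exists (j - i)%N, q0.
  by rewrite subn_gt0; split => //; apply/eqP; rewrite -subr_eq0 -/d d0.
have de : `|d| < e.
  rewrite dE normrM -(ltr_pM2r N0) mulrAC.
  apply: (@le_lt_trans _ _ (1 * `|T|)); last by rewrite mul1r mulrC.
  by rewrite ler_wpM2r // ltW.
(* The number of iterations is a natural number, so only nonnegative multiples of [d] are available;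
   the target is first moved by a multiple of T to the side of [d]. *)
have [M sMd] : exists M : int, 0 <= (s + M%:~R * T) / d.
  pose m := (Num.truncn (`|s| / `|T|)).+1.
  have mT : `|s| < m%:R * `|T| by rewrite -ltr_pdivrMr ?normr_gt0 // truncnS_gt.
  have [Td|Td] := leP 0 (T / d).
    exists m%:Z; rewrite mulrDl -mulrA -(ger0_norm Td) normrM normfV mulrA.
    have -> : (m%:Z%:~R : R) = m%:R by [].
    have h : `|s / d| <= m%:R * `|T| * `|d|^-1.
      by rewrite normrM normfV ler_wpM2r ?invr_ge0 // ltW.
    by have := ler_norm (- (s / d)); rewrite normrN; lra.
  exists (- m%:Z); rewrite mulrDl -mulrA -[T / d]opprK -(ltr0_norm Td).
  rewrite normrM normfV mulrNz mulrNN mulrA.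
  have -> : (m%:Z%:~R : R) = m%:R by [].
  have h : `|s / d| <= m%:R * `|T| * `|d|^-1.
    by rewrite normrM normfV ler_wpM2r ?invr_ge0 // ltW.
  by have := ler_norm (- (s / d)); rewrite normrN; lra.
pose K := Num.truncn ((s + M%:~R * T) / d).
have /andP[K1 K2] := truncn_itv sMd.
exists (K * (j - i))%N, (K%:Z * q0 + M).
have -> : (K * (j - i))%:R * tau - (K%:Z * q0 + M)%:~R * T - s
    = (K%:R - (s + M%:~R * T) / d) * d.
  rewrite mulrBl divfK // /d natrM rmorphD rmorphM /=; ring.
rewrite normrM; apply: le_lt_trans de; rewrite ger_pMl ?normr_gt0 //.
rewrite ler_norml; move: K1 K2; rewrite -/K -natr1 => K1 K2.
by apply/andP; split; lra.
Qed.

(** Membership in the pencil rests on a factorisation of the term free of y: b x^2 + (b^2 + a) x + a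
    b = (b x + a)(x + b) for k = 2, and b x^2 + (a + b c) x + a c = (b x + a)(x + c) for k = 3. *)
Definition lyness_biquad (R : comNzRingType) (k : nat) (a : nat -> R)
    (j : nat) : biquad R :=
  if k == 2%N then
    Biquad (a (j + 2)%N) (a (j + 1)%N) (a (j + 1)%N)
      (a (j + 2)%N + a (j + 1)%N ^+ 2) (a (j + 2)%N) (a (j + 1)%N) (a (j + 2)%N)
  else
    Biquad (a (j + 1)%N) (a (j + 2)%N) (a (j + 3)%N)
      (a (j + 3)%N + a (j + 1)%N * a (j + 2)%N)
      (a (j + 2)%N) (a (j + 1)%N) (a (j + 3)%N).

(** The recurrence on pairs of consecutive terms. The first step uses [a 1], so the pair (x 1, x 2)
    is sent to (x n.+1, x n.+2). *)
Fixpoint lyness_iter (R : realType) (a : nat -> R) (n : nat) (p : R * R) :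
    R * R :=
  if n is m.+1 then
    let: (x, y) := lyness_iter a m p in (y, (a m.+1 + y) / x)
  else p.

Section LynessDynamics.
Context {R : realType} (k : nat) (a : nat -> R).
Context (hk : k = 2%N \/ k = 3%N).
Context (a_per : periodic k a).
Context (a_gt0 : forall n : nat, (1 <= n)%N -> 0 < a n).
Implicit Types (x y h t : R) (p : R * R) (u v : R -> R).

Local Notation lq := (lyness_biquad k a).

(** The condition D(0) >= 0 holds because D(0) is a perfect square. *)
Lemma lyness_biquad_gt0 j : positive_biquad (lq j).
Proof.
have a1 : 0 < a (j + 1)%N by apply: a_gt0; rewrite addn1.
have a2 : 0 < a (j + 2)%N by apply: a_gt0; rewrite addn2.
have a3 : 0 < a (j + 3)%N by apply: a_gt0; rewrite addn3.
case: hk => ->; rewrite /lyness_biquad /=;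
  (split; [split => //=|split => //=|move=> /=]).
- by rewrite addr_gt0 // exprn_gt0.
- rewrite -subr_ge0.
  rewrite (_ : _ - _ = (a (j + 2)%N - a (j + 1)%N ^+ 2) ^+ 2).
    by rewrite sqr_ge0.
  by ring.
- by rewrite addr_gt0 // mulr_gt0.
- rewrite -subr_ge0.
  rewrite (_ : _ - _ = (a (j + 3)%N - a (j + 1)%N * a (j + 2)%N) ^+ 2).
    by rewrite sqr_ge0.
  by ring.
Qed.

Lemma quadP_lyness j h x y :
  quadP (lq j) h x y = lyness_num k a j x y - h * x * y.
Proof.
case: hk => ->; rewrite /lyness_num /= /quadP /quadA /quadB /quadC /=;
  rewrite /lyness_num2 /lyness_num3; ring.
Qed.

Lemma lyness_V_eq j h x y : 0 < x -> 0 < y ->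
  lyness_V k a j x y = h <-> quadP (lq j) h x y = 0.
Proof.
move=> x0 y0; have xy : x * y != 0 by rewrite gt_eqF // mulr_gt0.
rewrite quadP_lyness /lyness_V; split => [<-|/eqP].
  by rewrite -mulrA divfK // subrr.
by rewrite subr_eq0 -mulrA => /eqP ->; rewrite mulfK.
Qed.

Lemma lyness_V_step j x y : 0 < x -> 0 < y ->
  lyness_V k a j.+1 y ((a j.+1 + y) / x) = lyness_V k a j x y.
Proof.
move=> x0 y0; have aj := a_gt0 (ltn0Sn j).
have ay : a j.+1 + y != 0 by rewrite gt_eqF // addr_gt0.
have H : [&& x != 0, y != 0 & a j.+1 + y != 0].
  by rewrite ay !gt_eqF.
have := a_per (ltn0Sn j); case: hk => ek; rewrite ek /lyness_V /lyness_num /=.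
  rewrite !addn1 !addn2 => ->; rewrite /lyness_num2.
  by case/and3P: H => *; field; apply/and3P.
rewrite !addn1 !addn2 !addn3 => ->; rewrite /lyness_num3.
by case/and3P: H => *; field; apply/and3P.
Qed.

Lemma lyness_V_per j x y : lyness_V k a (j + k) x y = lyness_V k a j x y.
Proof.
have H i : a (j + k + i.+1)%N = a (j + i.+1)%N.
  by rewrite addnAC a_per // addnS.
by rewrite /lyness_V /lyness_num !H.
Qed.

Lemma lyness_biquad_per j : lq (j + k) = lq j.
Proof.
have H i : a (j + k + i.+1)%N = a (j + i.+1)%N.
  by rewrite addnAC a_per // addnS.
by rewrite /lyness_biquad !H.
Qed.

(** On P = 0 the field is xy (V_y, - V_x), the Hamiltonian field of V for the area form dx dy /
    (xy). The Lyness map preserves this form and carries V to the next V, so it respects the flows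
    without any change of time. *)
Lemma lyness_flow_step j h u v : flow (lq j) h u v ->
  flow (lq j.+1) h v (fun t => (a j.+1 + v t) / u t).
Proof.
move=> uv t; have [du dv u0 v0 P0] := uv t.
have aj := a_gt0 (ltn0Sn j).
have w0 : 0 < (a j.+1 + v t) / u t by rewrite divr_gt0 // addr_gt0.
have /(lyness_V_eq j h u0 v0) Vh := P0.
have Vh' := Vh; rewrite -lyness_V_step // in Vh'.
have un : u t != 0 by rewrite gt_eqF.
have vn : v t != 0 by rewrite gt_eqF.
have an : a j.+1 + v t != 0 by rewrite gt_eqF // addr_gt0.
have aper := a_per (ltn0Sn j).
have dV := @is_deriveV _ u _ _ _ un du.
split; [| |exact: v0|exact: w0|exact/lyness_V_eq].
  apply: is_derive_eq.
  rewrite -Vh; move: aper; case: hk => ek; rewrite ek;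
    rewrite /quadPx /quadPy /quadA /quadB /lyness_V /lyness_num
      /lyness_biquad /=;
    rewrite !addn1 !addn2 ?addn3 => ->;
    rewrite /lyness_num2 /lyness_num3; field;
    by rewrite ?un ?vn ?an.
apply: is_derive_eq.
rewrite -Vh; move: aper; case: hk => ek; rewrite ek;
  rewrite /GRing.scale /quadPx /quadPy /quadA /quadB /lyness_V /lyness_num
    /lyness_biquad /=;
  rewrite !addn1 !addn2 ?addn3 => ->; rewrite /lyness_num2 /lyness_num3; field;
  by rewrite ?un ?vn ?an.
Qed.

(** After k m steps the parameters repeat, so the remaining steps use the same ones as a fresh
    start. *)
Lemma lyness_iterD n p m :
  lyness_iter a (n + k * m) p = lyness_iter a n (lyness_iter a (k * m) p).
Proof.
have aE i : a (i.+1 + k * m)%N = a i.+1.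
  elim: m => [|m IH]; first by rewrite muln0 addn0.
  by rewrite mulnS addnCA addnC a_per // addSn.
elim: n => [//|n IH] /=.
by rewrite IH; case: (lyness_iter _ n _) => x y; rewrite -addSn aE.
Qed.

Lemma lyness_iter_gt0 n p : 0 < p.1 -> 0 < p.2 ->
  0 < (lyness_iter a n p).1 /\ 0 < (lyness_iter a n p).2.
Proof.
move=> p1 p2; elim: n => [//|n] /=; case: (lyness_iter a n p) => x y /= [x0 y0].
by split=> //; rewrite divr_gt0 // addr_gt0 // a_gt0.
Qed.

Lemma lyness_iter_V n p : 0 < p.1 -> 0 < p.2 ->
  lyness_V k a n (lyness_iter a n p).1 (lyness_iter a n p).2
  = lyness_V k a 0 p.1 p.2.
Proof.
move=> p1 p2; elim: n => [//|n] <- /=.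
have := lyness_iter_gt0 n p1 p2; case: (lyness_iter a n p) => x y /= [x0 y0].
exact: lyness_V_step.
Qed.

(** Each step has the inverse (x, y) -> ((a + x)/y, x), which preserves the open quadrant. *)
Lemma lyness_iter_surj j h x y : 0 < x -> 0 < y -> lyness_V k a j x y = h ->
  exists p, [/\ 0 < p.1, 0 < p.2, lyness_V k a 0 p.1 p.2 = h
              & lyness_iter a j p = (x, y)].
Proof.
elim: j x y => [|j IH] x y x0 y0 e; first by exists (x, y).
have aj := a_gt0 (ltn0Sn j).
have z0 : 0 < (a j.+1 + x) / y by rewrite divr_gt0 // addr_gt0.
have zK : (a j.+1 + x) / ((a j.+1 + x) / y) = y.
  by field; rewrite !gt_eqF // addr_gt0.
have [|p [p1 p2 pV pE]] := IH _ _ z0 x0.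
  by rewrite -lyness_V_step // zK.
by exists p; split=> //=; rewrite pE zK.
Qed.

Lemma lyness_iter_flow n h u v : flow (lq 0) h u v ->
  flow (lq n) h (fun t => (lyness_iter a n (u t, v t)).1)
                (fun t => (lyness_iter a n (u t, v t)).2).
Proof.
move=> uv; elim: n => [//|n IH].
have := lyness_flow_step IH; congr flow; apply/funext => t /=;
  by case: (lyness_iter a n _).
Qed.

(** The alternatives are those of [rotation_dichotomy], applied to the period [T] and to the time
    shift [tau] that k steps induce on the curve. *)
Lemma lyness_iter_dichotomy h u v (T : R) :
  flow (lq 0) h u v -> T != 0 -> u T = u 0 -> v T = v 0 ->
  (forall x y, 0 < x -> 0 < y -> quadP (lq 0) h x y = 0 ->
     exists t, u t = x /\ v t = y) ->
  (exists2 m, (0 < m)%N &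
     forall t, lyness_iter a (k * m) (u t, v t) = (u t, v t)) \/
  (forall t s e, 0 < e -> exists n t', [/\ `|t' - s| < e &
     lyness_iter a (k * n) (u t, v t) = (u t', v t')]).
Proof.
move=> uv T0 uT vT surj; have qpos := lyness_biquad_gt0 0.
have perT t : u (t + T) = u t /\ v (t + T) = v t.
  by apply: (flow_unique qpos (flow_shift T uv) uv); rewrite add0r.
have intS1 (n : nat) : (n.+1%:Z)%:~R = (n%:Z)%:~R + 1 :> R.
  by rewrite -!pmulrn -natr1.
have perz (z : int) t : u (t + z%:~R * T) = u t /\ v (t + z%:~R * T) = v t.
  elim/int_rec: z t => [|n IH|n IH] t.
  - by rewrite mul0r addr0.
  - have [e1 e2] := perT (t + n%:~R * T); have [e3 e4] := IH t.
    by rewrite -e3 -e4 -e1 -e2 -addrA intS1 mulrDl mul1r.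
  - have [e1 e2] := perT (t - n.+1%:~R * T); have [e3 e4] := IH t.
    rewrite -e3 -e4 mulrNz mulNr -e1 -e2 mulrNz mulNr.
    by rewrite intS1 mulrDl mul1r opprD !addrA !subrK.
have [tau [tu tv]] : exists tau, u tau = (lyness_iter a k (u 0, v 0)).1 /\
    v tau = (lyness_iter a k (u 0, v 0)).2.
  have := lyness_iter_flow k uv 0; rewrite -[k in lq k]add0n lyness_biquad_per.
  by case=> _ _ x0 y0 P0; exact: surj.
(* Both sides are flows on the same level and agree at time 0 by the choice of [tau]. *)
have step t : lyness_iter a k (u t, v t) = (u (t + tau), v (t + tau)).
  have := lyness_iter_flow k uv; rewrite -[k in lq k]add0n lyness_biquad_per.
  move=> uv'; have := flow_unique qpos uv' (flow_shift tau uv).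
  rewrite add0r tu tv => /(_ erefl erefl t) [<- <-].
  by case: (lyness_iter a k _).
have steps n t : lyness_iter a (k * n) (u t, v t)
    = (u (t + n%:R * tau), v (t + n%:R * tau)).
  elim: n => [|n IH]; first by rewrite muln0 mul0r addr0.
  rewrite mulnS lyness_iterD IH step -natr1 mulrDl mul1r.
  by rewrite addrA.
have [[m [z [m0 mz]]]|dense] := rotation_dichotomy tau T0.
  left; exists m => // t; rewrite steps mz.
  by have [-> ->] := perz z t.
right=> t s e e0; have [n [z nz]] := dense (s - t) e e0.
exists n, (t + n%:R * tau - z%:~R * T); split.
  by apply: le_lt_trans nz; rewrite le_eqVlt; apply/orP; left; apply/eqP;
    congr `|_|; ring.
rewrite steps; have := perz (- z) (t + n%:R * tau).
by rewrite mulrNz mulNr => -[-> ->].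
Qed.
End LynessDynamics.

(** * Disjoint intervals *)

(** Endpoints are functions of a parameter, so that overlaps can be decided uniformly along a
    filter. *)
Definition eval_itvs (R : realType) (T : Type)
    (s : seq ((T -> R) * (T -> R))) (t : T) : set R :=
  [set x | exists2 p, p \in s & p.1 t <= x <= p.2 t].

Lemma disjoint_itvs (R : realType) (T : Type)
    (s : seq ((T -> R) * (T -> R))) (t : T) d :
  (forall i, (i < size s)%N -> 0 < (nth d s i).1 t < (nth d s i).2 t) ->
  (forall i j, (i < j < size s)%N -> (nth d s i).2 t < (nth d s j).1 t \/
                                     (nth d s j).2 t < (nth d s i).1 t) ->
  is_disjoint_intervals (size s) (eval_itvs s t).
Proof.
move=> s0 sdis.
exists (fun i => (nth d s i).1 t), (fun i => (nth d s i).2 t); split.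
- by move=> i; exact: s0.
- move=> i j _ _ [x []]; rewrite /= !in_itv /= => /andP[i1 i2] /andP[j1 j2].
  apply/val_inj; case: (ltngtP i j) => // ij; exfalso.
    by have := sdis i j; rewrite ij ltn_ord => /(_ isT) []; lra.
  by have := sdis j i; rewrite ij ltn_ord => /(_ isT) []; lra.
- rewrite eqEsubset; split => x.
    move=> [p ps px]; have ps' : (index p s < size s)%N by rewrite index_mem.
    by exists (Ordinal ps') => //=; rewrite in_itv /= nth_index.
  move=> [i _]; rewrite /= in_itv /= => xi.
  by exists (nth d s i) => //; rewrite mem_nth.
Qed.

(* The filter is either the neighbourhoods of a level, which gives local
   constancy of the number of components, or a principal one. *)
Lemma filter_disjoint_itvs (R : realType) (T : Type) (F : set_system T)
    {FF : Filter F} (s : seq ((T -> R) * (T -> R))) :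
  (0 < size s)%N ->
  (forall p, p \in s -> \forall t \near F, 0 < p.1 t < p.2 t) ->
  (forall p q, p \in s -> q \in s ->
     (\forall t \near F, p.2 t < q.1 t) \/
     (\forall t \near F, q.1 t <= p.2 t)) ->
  exists m, (1 <= m <= size s)%N /\
    \forall t \near F, is_disjoint_intervals m (eval_itvs s t).
Proof.
have [n] := ubnP (size s); elim: n s => // n IH s sn s0 spos sdec.
pose d : (T -> R) * (T -> R) := (fun=> 0, fun=> 0).
(* Two intervals that eventually meet are replaced by their hull, which shortens the list; if there
   is no such pair, the intervals are eventually pairwise disjoint. *)
have [[p [q [s' [ps [pq qp]]]]]|H] := pselect (exists p q s',
    perm_eq s [:: p, q & s'] /\
    (\forall t \near F, q.1 t <= p.2 t) /\ (\forall t \near F, p.1 t <= q.2 t)).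
  have sz : size s = (size s').+2 by rewrite (perm_size ps).
  have ms : s =i [:: p, q & s'] by exact: perm_mem.
  have pS : p \in s by rewrite ms !inE eqxx.
  have qS : q \in s by rewrite ms !inE eqxx orbT.
  have sS r : r \in s' -> r \in s by rewrite ms !inE => ->; rewrite !orbT.
  pose pq' : (T -> R) * (T -> R) :=
    (fun t => Num.min (p.1 t) (q.1 t), fun t => Num.max (p.2 t) (q.2 t)).
  have pqpos : \forall t \near F, 0 < pq'.1 t < pq'.2 t.
    near=> t; have /andP[p1 p2] : 0 < p.1 t < p.2 t by near: t; exact: spos.
    have /andP[q1 q2] : 0 < q.1 t < q.2 t by near: t; exact: spos.
    by rewrite /= lt_min gt_min !lt_max p1 q1 p2.
  have [||||m [m1 m2]] := IH (pq' :: s').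
  - by rewrite /= -ltnS -sz.
  - by [].
  - by move=> r; rewrite inE => /predU1P[->//|/sS]; exact: spos.
  - move=> r1 r2; rewrite !inE => /predU1P[->|r1s] /predU1P[->|r2s].
    + right; near=> t; have /andP[_ /ltW//] : 0 < pq'.1 t < pq'.2 t.
      by near: t.
    + have [p2|p2] := sdec p r2 pS (sS _ r2s).
        have [q2|q2] := sdec q r2 qS (sS _ r2s).
          by left; near=> t; rewrite /= gt_max; apply/andP; split; near: t.
        by right; near=> t; rewrite /= le_max; apply/orP; right; near: t.
      by right; near=> t; rewrite /= le_max; apply/orP; left; near: t.
    + have [p2|p2] := sdec r1 p (sS _ r1s) pS.
        have [q2|q2] := sdec r1 q (sS _ r1s) qS.
          by left; near=> t; rewrite /= lt_min; apply/andP; split; near: t.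
        by right; near=> t; rewrite /= ge_min; apply/orP; right; near: t.
      by right; near=> t; rewrite /= ge_min; apply/orP; left; near: t.
    + by apply: sdec; exact: sS.
  exists m; split.
    by rewrite sz; case/andP: m1 => -> /= h; rewrite (leq_trans h).
  near=> t; have : is_disjoint_intervals m (eval_itvs (pq' :: s') t) by near: t.
  have t1 : q.1 t <= p.2 t by near: t.
  have t2 : p.1 t <= q.2 t by near: t.
  have /andP[_ tp] : 0 < p.1 t < p.2 t by near: t; exact: spos.
  have /andP[_ tq] : 0 < q.1 t < q.2 t by near: t; exact: spos.
  congr (is_disjoint_intervals m _); rewrite eqEsubset; split => x [r].
    rewrite inE => /predU1P[->|rs rx]; last by exists r => //; exact: sS.
    rewrite /= ge_min le_max => /andP[/orP xl /orP xr].
    have [px|px] := boolP (p.1 t <= x <= p.2 t); first by exists p.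
    exists q => //; move: px; rewrite negb_and -!ltNge => /orP px.
    by apply/andP; split; case: xl xr px => ? [] ? [] ?; lra.
  rewrite ms !inE => /orP[/eqP ->|/orP[/eqP->|rs]] rx.
  - exists pq'; first by rewrite inE eqxx.
    by case/andP: rx => x1 x2; rewrite /= ge_min le_max x1 x2.
  - exists pq'; first by rewrite inE eqxx.
    by case/andP: rx => x1 x2; rewrite /= ge_min le_max x1 x2 !orbT.
  - by exists r => //; rewrite inE rs orbT.
exists (size s); split; first by rewrite s0 leqnn.
have pos : \forall t \near F, forall i : 'I_(size s),
    0 < (nth d s i).1 t < (nth d s i).2 t.
  by apply: filter_forall => i; apply: spos; rewrite mem_nth.
have dis : \forall t \near F, forall ij : 'I_(size s) * 'I_(size s),
    (ij.1 < ij.2)%N -> (nth d s ij.1).2 t < (nth d s ij.2).1 t \/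
                     (nth d s ij.2).2 t < (nth d s ij.1).1 t.
  apply: filter_forall => -[i j] /=; case: (ltnP i j) => ij; last first.
    by near=> t.
  have iS : nth d s i \in s by rewrite mem_nth.
  have jS : nth d s j \in s by rewrite mem_nth.
  have [ij'|ij'] := sdec _ _ iS jS; first by near=> t; left; near: t.
  have [ji'|ji'] := sdec _ _ jS iS; first by near=> t; right; near: t.
  exfalso; apply: H; exists (nth d s i), (nth d s j).
  exists (rem (nth d s j) (take i s ++ drop i.+1 s)); split; last by [].
  have jm : nth d s j \in take i s ++ drop i.+1 s.
    rewrite mem_cat; apply/orP; right.
    have -> : nth d s j = nth d (drop i.+1 s) (j - i.+1).
      by rewrite nth_drop subnKC.
    by rewrite mem_nth // size_drop ltn_sub2r // (leq_ltn_trans ij).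
  apply: (@perm_trans _ (nth d s i :: (take i s ++ drop i.+1 s))).
    rewrite -{1}(cat_take_drop i s) (drop_nth d) //.
    by rewrite -cat_rcons -cats1 -cat1s -catA perm_catCA.
  by rewrite perm_cons perm_to_rem.
near=> t; apply: (@disjoint_itvs _ _ _ _ d).
  move=> i si.
  have : forall i : 'I_(size s), 0 < (nth d s i).1 t < (nth d s i).2 t.
    by near: t.
  by move=> /(_ (Ordinal si)).
move=> i j /andP[ij sj].
have : forall ij : 'I_(size s) * 'I_(size s),
    (ij.1 < ij.2)%N -> (nth d s ij.1).2 t < (nth d s ij.2).1 t \/
                     (nth d s ij.2).2 t < (nth d s ij.1).1 t by near: t.
by move=> /(_ (Ordinal (ltn_trans ij sj), Ordinal sj)); apply.
Unshelve. all: by end_near. Qed.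

(* The left endpoints are the points of A that are isolated in A from the
   left. *)
Lemma disjoint_intervals_left_ends (R : realType) (m : nat) (A : set R)
    (l r : 'I_m -> R) :
  (forall i, 0 < l i < r i) -> trivIset setT (fun i => `[l i, r i]%classic) ->
  A = \bigcup_(i in setT) `[l i, r i]%classic ->
  injective l /\
  forall x, (exists i, l i = x) <->
    (A x /\ exists2 e, 0 < e & forall y, x - e < y -> y < x -> ~ A y).
Proof.
move=> lr /trivIsetP dis ->.
have far i j : i != j -> r i < l j \/ r j < l i.
  move=> ij; have := dis i j I I ij; rewrite -subset0 => sub.
  have /andP[_ lri] := lr i; have /andP[_ lrj] := lr j.
  have [?|rl] := ltP (r i) (l j); [by left|].
  have [?|rl'] := ltP (r j) (l i); [by right|].
  exfalso; apply: (sub (Num.max (l i) (l j))); split; rewrite /= in_itv /=.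
    by rewrite le_max lexx ge_max (ltW lri).
  by rewrite le_max lexx orbT ge_max (ltW lrj) andbT.
split.
  move=> i j lij; apply/eqP; apply: contraT => /far.
  by have := lr i; have := lr j; rewrite lij => /andP[? ?] /andP[? ?] [] ?; lra.
move=> x; split.
  move=> [i <-]; split.
    by exists i => //=; rewrite in_itv /= lexx ltW //; case/andP: (lr i).
  (* Distance to the intervals on the left, with default value 1 for the others; the minimum is the
     radius of isolation. *)
  pose gap j := if r j < l i then l i - r j else 1.
  have gap0 j : 0 < gap j by rewrite /gap; case: ifP => // ?; rewrite subr_gt0.
  exists (\big[Num.min/1]_j gap j).
    by elim/big_ind : _ => // a b a0 b0; rewrite lt_min a0.
  move=> y y1 y2 [j _]; rewrite /= in_itv /= => /andP[lj rj].
  have [e|/far[]] := eqVneq i j.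
  - by move: lj; rewrite -e; lra.
  - by have := lr i; lra.
  - move=> rjl.
    have : \big[Num.min/1]_j gap j <= gap j by exact: bigmin_le_cond.
    by rewrite /gap rjl; lra.
move=> [[i _]]; rewrite /= in_itv /= => /andP[lx xr] [e e0 H].
exists i; apply/eqP; rewrite eq_le lx /= leNgt; apply/negP => lx'.
(* If [x] were not the left end of its interval, this point of the same interval would lie in the
   forbidden gap. *)
have /andP[? ?] : (x - e < Num.max (l i) (x - e / 2)) &&
    (Num.max (l i) (x - e / 2) < x).
  by rewrite lt_max gt_max lx' /=; apply/andP; split; [apply/orP; right|]; lra.
apply: (H (Num.max (l i) (x - e / 2))) => //.
exists i => //=; rewrite in_itv /= le_max lexx /=; lra.
Qed.

(** The number of components is the number of left endpoints, which depend on [A] alone. *)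
Lemma is_disjoint_intervals_uniq (R : realType) (m1 m2 : nat) (A : set R) :
  is_disjoint_intervals m1 A -> is_disjoint_intervals m2 A -> m1 = m2.
Proof.
wlog suff : m1 m2 / is_disjoint_intervals m1 A -> is_disjoint_intervals m2 A ->
    (m1 <= m2)%N.
  by move=> le h1 h2; apply/eqP; rewrite eqn_leq !le.
move=> [l1 [r1 [p1 t1 e1]]] [l2 [r2 [p2 t2 e2]]].
have [i1 c1] := disjoint_intervals_left_ends p1 t1 e1.
have [_ c2] := disjoint_intervals_left_ends p2 t2 e2.
have H i : exists j, l2 j = l1 i by apply/c2/c1; exists i.
pose f i := projT1 (cid (H i)).
have fE i : l2 (f i) = l1 i by rewrite /f; case: cid.
have : injective f by move=> i j fij; apply: i1; rewrite -!fE fij.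
by move=> /leq_card; rewrite !card_ord.
Qed.

(** * Projections of the level curves *)

(* The minimum of V(x, y) over y > 0, by the AM-GM inequality. *)
Definition least_level (R : realType) (q : biquad R) (x : R) : R :=
  (ga q * x ^+ 2 + de q + 2 * Num.sqrt (quadA q x * quadC q x)) / x.

Definition oval_roots (R : realType) (q : biquad R) (h e1 l r e4 : R) : Prop :=
  [/\ [/\ 0 <= e1, e1 < l, l < r & r < e4],
      discP q h = ga q ^+ 2 *: (('X - e1%:P) * ('X - l%:P)
                                * ('X - r%:P) * ('X - e4%:P)),
      forall x, l <= x <= r -> quadB q h x < 0
    & forall x, 0 < x -> quadB q h x < 0 -> 0 <= (discP q h).[x] ->
        l <= x <= r].

(** * The projection as a sublevel set of [least_level] *)

Section LeastLevel.
Context {R : realType} {q : biquad R}.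
Context (qpos : positive_biquad q).
Implicit Types x y h : R.

Lemma quadA_gt0 x : 0 < x -> 0 < quadA q x.
Proof.
by case: qpos => [[? ? _ _] _ _] x0; rewrite addr_gt0 // mulr_gt0.
Qed.

Lemma quadC_gt0 x : 0 < x -> 0 < quadC q x.
Proof.
by case: qpos => [_ [? ? ?] _] x0; rewrite mulr_gt0 // addr_gt0 // mulr_gt0.
Qed.

(** The bound reads 2 sqrt(AC) <= - B, that is B < 0 and 4AC <= B^2; strictness of B < 0 comes from
    AC > 0. *)
Lemma least_level_le h x : 0 < x ->
  least_level q x <= h <-> quadB q h x < 0 /\ 0 <= (discP q h).[x].
Proof.
move=> x0; rewrite horner_discP /least_level.
have AC : 0 < quadA q x * quadC q x by rewrite mulr_gt0 ?quadA_gt0 ?quadC_gt0.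
have s0 : 0 < Num.sqrt (quadA q x * quadC q x) by rewrite sqrtr_gt0.
rewrite ler_pdivrMr // -mulrA -{2}(sqr_sqrtr (ltW AC)).
have -> : ga q * x ^+ 2 + de q = quadB q h x + h * x by rewrite /quadB; ring.
move: (Num.sqrt _) s0 => s s0.
by split => [|[B0 D0]]; [split|]; nra.
Qed.

Lemma least_level_lt h x : 0 < x ->
  least_level q x < h <-> quadB q h x < 0 /\ 0 < (discP q h).[x].
Proof.
move=> x0; rewrite horner_discP /least_level.
have AC : 0 < quadA q x * quadC q x by rewrite mulr_gt0 ?quadA_gt0 ?quadC_gt0.
have s0 : 0 < Num.sqrt (quadA q x * quadC q x) by rewrite sqrtr_gt0.
rewrite ltr_pdivrMr // -mulrA -{2}(sqr_sqrtr (ltW AC)).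
have -> : ga q * x ^+ 2 + de q = quadB q h x + h * x by rewrite /quadB; ring.
move: (Num.sqrt _) s0 => s s0.
by split => [|[B0 D0]]; [split|]; nra.
Qed.

Lemma exists_quadP0 h x : 0 < x ->
  (exists2 y, 0 < y & quadP q h x y = 0) <-> least_level q x <= h.
Proof.
move=> x0; have A0 := quadA_gt0 x0; have C0 := quadC_gt0 x0.
split=> [[y y0 P0]|/(least_level_le _ x0)[B0 D0]].
  apply/(least_level_le _ x0); have [B0 _] := quadP_bound qpos x0 y0 P0.
  by split=> //; rewrite (discP_quadPy q h x y) P0 mulr0 subr0 sqr_ge0.
have s0 := sqrtr_ge0 (discP q h).[x].
(* The larger root in y, positive since B < 0 < A. *)
exists ((Num.sqrt (discP q h).[x] - quadB q h x) / (2 * quadA q x)).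
  by rewrite divr_gt0 ?mulr_gt0 //; lra.
have e :
    quadPy q h x ((Num.sqrt (discP q h).[x] - quadB q h x) / (2 * quadA q x))
    = Num.sqrt (discP q h).[x].
  by rewrite /quadPy; field; rewrite gt_eqF.
move: e; set y := _ / _ => e.
have := discP_quadPy q h x y; rewrite e sqr_sqrtr //.
move/eqP; rewrite -subr_eq0 opprB addrC subrK !mulf_eq0.
by rewrite (gt_eqF A0) pnatr_eq0 /= => /eqP.
Qed.

Lemma least_level_of_quadP h x y : 0 < x -> 0 < y ->
  quadP q h x y < 0 -> least_level q x < h.
Proof.
move=> x0 y0 P0; have A0 := quadA_gt0 x0; have C0 := quadC_gt0 x0.
apply/(least_level_lt _ x0); split.
  rewrite -(pmulr_llt0 _ y0); move: P0; rewrite /quadP.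
  have : 0 < quadA q x * y ^+ 2 by rewrite mulr_gt0 // exprn_gt0.
  lra.
rewrite (discP_quadPy q h x y) subr_gt0; apply: lt_le_trans (sqr_ge0 _).
by rewrite pmulr_rlt0 // mulr_gt0.
Qed.

Lemma oval_rootsP h :
  (exists2 x0, 0 < x0 & least_level q x0 < h) ->
  exists e1 l r e4, oval_roots q h e1 l r e4.
Proof.
move=> [x0 x00 /(least_level_lt _ x00)[B0 D0]].
have [e1 [l [r [e4 [ord [_ DE Bn Dlr]]]]]] := quad_oval qpos x00 B0 D0.
by exists e1, l, r, e4.
Qed.

Lemma oval_roots_discP h e1 l r e4 x : oval_roots q h e1 l r e4 ->
  (discP q h).[x] = ga q ^+ 2 * ((x - e1) * (x - l) * (x - r) * (x - e4)).
Proof. by case=> _ -> _ _; rewrite hornerZ !hornerM !hornerXsubC. Qed.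

Lemma oval_roots_le h e1 l r e4 x : oval_roots q h e1 l r e4 -> 0 < x ->
  least_level q x <= h <-> l <= x <= r.
Proof.
move=> o x0; have DE := oval_roots_discP x o.
case: o => [[e10 e1l lr re4] _ Bn Dlr].
split=> [/(least_level_le _ x0) []|lxr]; first exact: Dlr.
apply/(least_level_le _ x0); split; first exact: Bn.
rewrite DE.
have -> : (x - e1) * (x - l) * (x - r) * (x - e4)
   = ((x - e1) * (e4 - x)) * ((x - l) * (r - x)) by ring.
have [[_ _ ga0 _] _ _] := qpos.
by case/andP: lxr => lx xr; rewrite !mulr_ge0 //; lra.
Qed.

Lemma oval_roots_lt h e1 l r e4 x : oval_roots q h e1 l r e4 ->
  l < x < r -> least_level q x < h.
Proof.
move=> o /andP[lx xr]; have DE := oval_roots_discP x o.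
case: o => [[e10 e1l lr re4] _ Bn Dlr].
have [[_ _ ga0 _] _ _] := qpos.
apply/least_level_lt; first lra.
split; first by apply: Bn; rewrite !ltW.
rewrite DE.
have -> : (x - e1) * (x - l) * (x - r) * (x - e4)
   = ((x - e1) * (e4 - x)) * ((x - l) * (r - x)) by ring.
by rewrite !mulr_gt0 ?exprn_gt0 //; lra.
Qed.
End LeastLevel.

(** Infimum and supremum are total functions of the level; on nondegenerate levels they are the two
    middle roots of the discriminant. *)
Definition proj_ends (R : realType) (k : nat) (a : nat -> R) (j : nat) :
    (R -> R) * (R -> R) :=
  (fun h => inf (level_proj k a j h), fun h => sup (level_proj k a j h)).

(** * Projections and their endpoints as functions of the level *)

Section LevelProjections.
Context {R : realType} (k : nat) (a : nat -> R).
Context (hk : k = 2%N \/ k = 3%N).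
Context (a_per : periodic k a).
Context (a_gt0 : forall n : nat, (1 <= n)%N -> 0 < a n).
Implicit Types (x y h : R) (i j : nat).

Local Notation lq := (lyness_biquad k a).
Local Notation lo j := (proj_ends k a j).1.
Local Notation hi j := (proj_ends k a j).2.

Let qpos j : positive_biquad (lq j) := lyness_biquad_gt0 hk a_gt0 j.

Lemma level_projP j h x :
  level_proj k a j h x <-> 0 < x /\ least_level (lq j) x <= h.
Proof.
split.
  move=> [[u v] [/= u0 v0 /(lyness_V_eq _ hk _ _ u0 v0) uv] <-]; split=> //.
  by apply/(exists_quadP0 (qpos j)) => //; exists v.
move=> [x0 /(exists_quadP0 (qpos j) _ x0)[y y0 P0]].
by exists (x, y) => //; split => //=; apply/lyness_V_eq.
Qed.

(** The point witnessing nondegeneracy for index 0 is carried by j Lyness steps, which keep the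
    value of V. *)
Lemma nondegenerate_least_level j h : nondegenerate_level k a h ->
  exists2 x, 0 < x & least_level (lq j) x < h.
Proof.
move=> [u [v [u0 v0 uv]]].
have [x0 y0] := @lyness_iter_gt0 _ _ a_gt0 j (u, v) u0 v0.
have := @lyness_iter_V _ _ _ hk a_per a_gt0 j (u, v) u0 v0.
set p := lyness_iter a j (u, v) in x0 y0 *; rewrite /= => pV.
exists p.1 => //; apply: (least_level_of_quadP (qpos j) x0 y0).
have /(lyness_V_eq _ hk _ _ x0 y0) := pV; rewrite !quadP_lyness // => e.
have : 0 < (h - lyness_V k a 0 u v) * (p.1 * p.2).
  by rewrite !mulr_gt0 ?subr_gt0.
by move: e; lra.
Qed.

Lemma nondegenerate_near h : nondegenerate_level k a h ->
  \forall h' \near h, nondegenerate_level k a h'.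
Proof.
move=> [u [v [u0 v0 uv]]]; near=> h'; exists u, v; split => //.
by near: h'; exact: lt_nbhsr.
Unshelve. all: by end_near. Qed.

Lemma level_oval j h : nondegenerate_level k a h ->
  exists e1 e4, oval_roots (lq j) h e1 (lo j h) (hi j h) e4 /\
    level_proj k a j h = `[lo j h, hi j h]%classic.
Proof.
move=> /(nondegenerate_least_level j)/(oval_rootsP (qpos j)).
move=> [e1 [l [r [e4 orr]]]].
have [[e10 e1l lr _] _ _ _] := orr.
have pE : level_proj k a j h = `[l, r]%classic.
  rewrite eqEsubset; split => x.
    move=> /level_projP[x0]; move/(oval_roots_le (qpos j) orr x0).
    by rewrite /= in_itv.
  rewrite /= in_itv /= => lxr; have x0 : 0 < x by lra.
  by apply/level_projP; split=> //; apply/(oval_roots_le (qpos j) orr x0).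
by exists e1, e4; rewrite /= pE inf_itvcc ?sup_itvcc ?(ltW lr).
Qed.

Lemma proj_ends_lt j h : nondegenerate_level k a h -> 0 < lo j h < hi j h.
Proof.
move=> /(level_oval j)[e1 [e4 [[[e10 e1l lr _] _ _ _] _]]].
by rewrite lr (le_lt_trans e10 e1l).
Qed.

Lemma proj_ends_le j h x : nondegenerate_level k a h -> 0 < x ->
  least_level (lq j) x <= h <-> lo j h <= x <= hi j h.
Proof.
move=> /(level_oval j)[e1 [e4 [orr _]]].
exact: (oval_roots_le (qpos j) orr).
Qed.

(** Points strictly inside the projection stay inside, and points outside stay outside, for all
    levels near [h]; such points bracket each end. *)
Lemma proj_ends_near j h (e : R) : nondegenerate_level k a h -> 0 < e ->
  \forall h' \near h, `|lo j h - lo j h'| < e /\ `|hi j h - hi j h'| < e.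
Proof.
move=> nd e0; have /andP[l0 lr] := proj_ends_lt j nd.
have [e1 [e4 [orr _]]] := level_oval j nd.
pose c := (lo j h + hi j h) / 2.
(* The bounds [lo j h / 2] and [c] keep the test points positive and the inner ones inside the
   interval, however large [e] is. *)
pose l' := Num.max (lo j h - e / 2) (lo j h / 2).
pose l'' := Num.min (lo j h + e / 2) c.
pose r' := hi j h + e / 2.
pose r'' := Num.max (hi j h - e / 2) c.
have cE : lo j h < c < hi j h by rewrite /c; apply/andP; split; lra.
have l'1 : lo j h - e < l' by rewrite lt_max; apply/orP; left; lra.
have l'2 : 0 < l' by rewrite lt_max; apply/orP; right; lra.
have l'3 : l' < lo j h by rewrite gt_max; apply/andP; split; lra.
have l''1 : l'' < lo j h + e by rewrite gt_min; apply/orP; left; lra.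
have l''2 : lo j h < l'' < hi j h.
  rewrite lt_min gt_min; apply/andP.
  split; [apply/andP; split|apply/orP; right];
  by case/andP: cE; lra.
have r''1 : hi j h - e < r'' by rewrite lt_max; apply/orP; left; lra.
have r''2 : lo j h < r'' < hi j h.
  rewrite lt_max gt_max; apply/andP.
  split; [apply/orP; right|apply/andP; split];
  by case/andP: cE; lra.
have W x : lo j h < x < hi j h ->
    \forall h' \near h, least_level (lq j) x <= h'.
  move=> xlr; have := oval_roots_lt (qpos j) orr xlr => lt.
  by near=> h'; apply/ltW; near: h'; exact: lt_nbhsr.
have N x : 0 < x -> ~~ (lo j h <= x <= hi j h) ->
    \forall h' \near h, h' < least_level (lq j) x.
  move=> x0 xlr; apply: lt_nbhsl; rewrite ltNge; apply: contra xlr => xlr.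
  exact/(proj_ends_le j nd x0).
have l'N : ~~ (lo j h <= l' <= hi j h) by rewrite leNgt l'3.
have r'N : ~~ (lo j h <= r' <= hi j h).
  by rewrite negb_and -!ltNge; apply/orP; right; rewrite /r'; lra.
have r'0 : 0 < r' by rewrite /r'; lra.
have r'1 : hi j h < r' by rewrite /r'; lra.
have r'2 : r' < hi j h + e by rewrite /r'; lra.
near=> h'.
have nd' : nondegenerate_level k a h' by near: h'; exact: nondegenerate_near.
have l''0 : 0 < l'' by have /andP[? ?] := l''2; lra.
have r''0 : 0 < r'' by have /andP[? ?] := r''2; lra.
have /(proj_ends_le j nd' l''0) : least_level (lq j) l'' <= h'.
  by near: h'; exact: (W _ l''2).
have /(proj_ends_le j nd' r''0) : least_level (lq j) r'' <= h'.
  by near: h'; exact: (W _ r''2).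
have nl : h' < least_level (lq j) l' by near: h'; exact: (N _ l'2 l'N).
have nr : h' < least_level (lq j) r' by near: h'; exact: (N _ r'0 r'N).
have {}nl : ~~ (lo j h' <= l' <= hi j h').
  by apply/negP => /(proj_ends_le j nd' l'2); rewrite leNgt nl.
have {}nr : ~~ (lo j h' <= r' <= hi j h').
  by apply/negP => /(proj_ends_le j nd' r'0); rewrite leNgt nr.
move=> /andP[r1 r2] /andP[l1 l2].
move: nl nr; rewrite !negb_and -!ltNge => /orP nl /orP nr.
have nl' : l' < lo j h' by case: nl => // ?; have /andP[? ?] := l''2; lra.
have nr' : hi j h' < r' by case: nr => // ?; have /andP[? ?] := r''2; lra.
rewrite !ltr_norml; split; apply/andP; split; lra.
Unshelve. all: by end_near. Qed.

Lemma proj_lo_continuous j h : nondegenerate_level k a h ->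
  {for h, continuous (lo j)}.
Proof.
move=> nd; apply/cvgrPdist_lt => e e0; near=> h'.
have [//] : `|lo j h - lo j h'| < e /\ `|hi j h - hi j h'| < e.
by near: h'; exact: proj_ends_near.
Unshelve. all: by end_near. Qed.

Lemma proj_hi_continuous j h : nondegenerate_level k a h ->
  {for h, continuous (hi j)}.
Proof.
move=> nd; apply/cvgrPdist_lt => e e0; near=> h'.
have [//] : `|lo j h - lo j h'| < e /\ `|hi j h - hi j h'| < e.
by near: h'; exact: proj_ends_near.
Unshelve. all: by end_near. Qed.

Lemma level_projsE h : nondegenerate_level k a h ->
  level_projs k a h = eval_itvs [seq proj_ends k a j | j <- iota 0 k] h.
Proof.
move=> nd; rewrite eqEsubset; split => x.
  move=> [j /= jk]; have [_ [_ [_ ->]]] := level_oval j nd.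
  rewrite /= in_itv => xj; exists (proj_ends k a j) => //.
  by rewrite map_f // mem_iota.
move=> [_ /mapP[j jk ->] xj]; exists j; first by move: jk; rewrite mem_iota.
by have [_ [_ [_ ->]]] := level_oval j nd; rewrite /= in_itv.
Qed.

Lemma level_projs_count h : nondegenerate_level k a h ->
  exists m, (1 <= m <= k)%N /\ is_disjoint_intervals m (level_projs k a h).
Proof.
(* For the principal filter at [h], every comparison of endpoints is decided. *)
move=> nd; pose F := globally [set h].
have [|||m [m1 m2]] := @filter_disjoint_itvs R R F _
    [seq proj_ends k a j | j <- iota 0 k].
- by rewrite size_map size_iota; case: hk => ->.
- by move=> _ /mapP[j _ ->] _ ->; exact: proj_ends_lt.
- move=> _ _ /mapP[i _ ->] /mapP[j _ ->].
  by have [lt|le] := ltP (hi i h) (lo j h); [left|right] => _ ->.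
- exists m; rewrite size_map size_iota in m1; split=> //.
  by rewrite level_projsE //; exact: m2.
Qed.

(** When no right end equals a left end, all comparisons between them are strict, hence stable near
    [h] by continuity. *)
Lemma level_projs_count_near h : nondegenerate_level k a h ->
  (forall i j, (i < k)%N -> (j < k)%N -> hi i h != lo j h) ->
  exists m, \forall h' \near h, is_disjoint_intervals m (level_projs k a h').
Proof.
move=> nd ne.
have [|||m [m1 m2]] := @filter_disjoint_itvs R R (nbhs h) _
    [seq proj_ends k a j | j <- iota 0 k].
- by rewrite size_map size_iota; case: hk => ->.
- move=> _ /mapP[j _ ->]; near=> h'; apply: proj_ends_lt.
  by near: h'; exact: nondegenerate_near.
- move=> _ _ /mapP[i ik ->] /mapP[j jk ->].
  have d : (fun h' => lo j h' - hi i h') @ h --> lo j h - hi i h.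
    by apply: cvgB; [exact: proj_lo_continuous|exact: proj_hi_continuous].
  have := ne i j; rewrite !mem_iota /= in ik jk; move=> /(_ ik jk).
  rewrite neq_lt => /orP[lt|lt].
    left; near=> h'; rewrite -subr_gt0; near: h'.
    by apply: (cvgr_gt _ d); rewrite subr_gt0.
  right; near=> h'; rewrite -subr_le0; apply/ltW; near: h'.
  by apply: (cvgr_lt _ d); rewrite subr_lt0.
- exists m; near=> h'; rewrite level_projsE; first by near: h'.
  by near: h'; exact: nondegenerate_near.
Unshelve. all: by end_near. Qed.

(** Without a bifurcation value, the levels with [m1] intervals would form an open and closed part
    of the connected segment [h1, h2]. *)
Lemma bifurcation_between h1 h2 m1 m2 :
  nondegenerate_level k a h1 -> h1 < h2 ->
  is_disjoint_intervals m1 (level_projs k a h1) ->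
  is_disjoint_intervals m2 (level_projs k a h2) -> m1 <> m2 ->
  exists h, [/\ h1 <= h, h <= h2 & bifurcation_value k a h].
Proof.
move=> nd1 h12 d1 d2 ne; apply: contrapT => nb.
have nd h : h1 <= h -> nondegenerate_level k a h.
  by case: nd1 => u [v [u0 v0 uv]] hh; exists u, v; split=> //; lra.
have loc h : h1 <= h <= h2 ->
    exists m, \forall h' \near h, is_disjoint_intervals m (level_projs k a h').
  move=> /andP[h1h hh2]; apply: contrapT => H; apply: nb; exists h; split=> //.
  by split=> //; exact: nd.
pose P := [set h | is_disjoint_intervals m1 (level_projs k a h)].
have dec h : h1 <= h <= h2 -> P h -> P^° h.
  move=> /loc[m mh] Ph; have mm : m = m1.
    exact: is_disjoint_intervals_uniq (nbhs_singleton mh) Ph.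
  by move: mh; rewrite mm.
have decN h : h1 <= h <= h2 -> ~ P h -> (~` P)^° h.
  move=> /loc[m mh] Ph; near=> h' => Ph'; apply: Ph.
  have mh' : is_disjoint_intervals m (level_projs k a h') by near: h'.
  rewrite /P /= -(is_disjoint_intervals_uniq mh' Ph').
  exact: nbhs_singleton mh.
have PE : `[h1, h2]%classic `&` P = `[h1, h2]%classic.
  apply: (@segment_connected R h1 h2).
  - by exists h1; split=> //; rewrite /= in_itv /= lexx ltW.
  - exists P^°; first exact: open_interior.
    rewrite eqEsubset; split => h [] /=; rewrite in_itv /= => hh Ph.
      by split=> //; exact: dec.
    by split=> //; exact: interior_subset.
  - exists (~` (~` P)^°); first exact/open_closedC/open_interior.
    rewrite eqEsubset; split => h [] /=; rewrite in_itv /= => hh Ph; split=> //.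
      by move=> /interior_subset.
    by apply: contrapT => /(decN _ hh).
have : P h2.
  have : `[h1, h2]%classic h2 by rewrite /= in_itv /= lexx ltW.
  by rewrite -PE => -[].
by move=> /is_disjoint_intervals_uniq /(_ d2).
Unshelve. all: by end_near. Qed.
End LevelProjections.

(** * Resultants *)

Lemma poly_roots_list (F : fieldType) (p : {poly F}) : p != 0 ->
  exists rs : seq F, forall x, root p x -> x \in rs.
Proof.
have [n] := ubnP (size p); elim: n p => // n IH p sp p0.
have [[z]|nr] := pselect (exists z, root p z); last first.
  by exists [::] => x px; exfalso; apply: nr; exists x.
move=> /factor_theorem[q pE].
have q0 : q != 0 by apply: contraNneq p0 => q0; rewrite pE q0 mul0r.
have [|rs Hrs] := IH q _ q0.
  by move: sp; rewrite pE size_Mmonic ?monicXsubC // size_XsubC addn2.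
exists (z :: rs) => x; rewrite pE rootM root_XsubC inE => /orP[/Hrs ->|->] //.
by rewrite orbT.
Qed.

Section Resultants.
Context {R : realType}.
Implicit Types (q : biquad R) (x h : R).

Lemma horner_discP_h q h x :
  (discP q h).[x] = ((poly_B0 q).[x] - h * x) ^+ 2 - (poly_4AC q).[x].
Proof.
by rewrite /discP hornerD hornerN horner_exp hornerD hornerN hornerZ hornerX.
Qed.

(* Eliminating h between the equations (A_1 - h x)^2 = B_1 and
   (A_2 - h x)^2 = B_2 of two discriminants. *)
Definition h_eliminant q1 q2 : {poly R} :=
  ((poly_B0 q1 - poly_B0 q2) ^+ 2 - (poly_4AC q1 + poly_4AC q2)) ^+ 2
  - 4 *: (poly_4AC q1 * poly_4AC q2).

Lemma h_eliminant_root q1 q2 h x :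
  root (discP q1 h) x -> root (discP q2 h) x -> root (h_eliminant q1 q2) x.
Proof.
move=> /rootP + /rootP; rewrite !horner_discP_h => /eqP + /eqP.
rewrite !subr_eq0 => /eqP e1 /eqP e2; apply/rootP.
rewrite /h_eliminant hornerD hornerN hornerZ horner_exp hornerM hornerD hornerN.
rewrite horner_exp (hornerD (poly_B0 q1)) (hornerD (poly_4AC q1)) hornerN.
by rewrite -e1 -e2; ring.
Qed.

(** The term (ga q1 - ga q2)^4 X^8 survives: the corrections have degree at most 3 inside the square
    and at most 6 outside. *)
Lemma h_eliminant_neq0 q1 q2 : ga q1 != ga q2 -> h_eliminant q1 q2 != 0.
Proof.
move=> g12; have g0 : ga q1 - ga q2 != 0 by rewrite subr_eq0.
have s4 : (size (poly_4AC q1 + poly_4AC q2)%R <= 4)%N.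
  by rewrite (leq_trans (size_polyD _ _)) // geq_max !size_poly_4AC.
have s7 : (size (4 *: (poly_4AC q1 * poly_4AC q2) : {poly R})%R <= 7)%N.
  rewrite (leq_trans (size_scale_leq _ _)) //.
  rewrite (leq_trans (size_polyMleq _ _)) // -subn1 leq_subLR.
  by rewrite (leq_add (size_poly_4AC _) (size_poly_4AC _)).
have BE : poly_B0 q1 - poly_B0 q2 =
    (ga q1 - ga q2) *: 'X^2 + (0 *: 'X + (de q1 - de q2)%:P).
  by rewrite /poly_B0 scalerBl scale0r add0r polyCB opprD addrACA.
have := size_lead_sqr (size_lead_quadratic 0 (de q1 - de q2) g0).
rewrite -BE /h_eliminant => -[s5 l5].
have [|s5' _] := size_lead_polyDl s5 l5 (r := - (poly_4AC q1 + poly_4AC q2)).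
  by rewrite size_polyN ltnS.
move: (_ ^+ 2 - _) s5' => P sP.
have P0 : P != 0 by rewrite -size_poly_eq0 sP.
have sP2 : size (P ^+ 2) = 9%N by rewrite size_mul // sP.
by rewrite -size_poly_eq0 size_polyDl sP2 // size_polyN ltnS (leq_trans s7).
Qed.

Lemma discP_large q x : x != 0 ->
  exists H, forall h, H <= h -> ~~ root (discP q h) x.
Proof.
move=> x0; pose A := (poly_B0 q).[x]; pose B := (poly_4AC q).[x].
exists ((`|A| + `|B| + 1) / `|x|) => h; rewrite ler_pdivrMr ?normr_gt0 // => hx.
rewrite rootE horner_discP_h -/A -/B.
have h0 : 0 < h.
  have : 0 < h * `|x| by apply: lt_le_trans hx; rewrite ltr_wpDl ?addr_ge0.
  by rewrite pmulr_lgt0 // normr_gt0.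
have B1 : `|B| + 1 <= `|A - h * x|.
  rewrite distrC; have := lerB_dist (h * x) A.
  by rewrite normrM (gtr0_norm h0); lra.
rewrite gt_eqF // -(real_normK (num_real (A - h * x))).
have := normr_ge0 B; have := ler_norm B; nra.
Qed.

(** The point 0 is excluded because the value of [discP q h] there does not depend on [h]. *)
Lemma discP_large_seq q (rs : seq R) :
  exists H, forall h x, H <= h -> x \in rs -> x != 0 -> ~~ root (discP q h) x.
Proof.
elim: rs => [|z rs [H IH]]; first by exists 0.
have [->|z0] := eqVneq z 0.
  exists H => h x Hh; rewrite inE => /predU1P[->|]; last exact: IH.
  by rewrite eqxx.
have [H' H'P] := discP_large q z0.
exists (Num.max H H') => h x; rewrite ge_max => /andP[Hh Hh'].
rewrite inE => /predU1P[-> _|]; [exact: H'P|exact: IH].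
Qed.

(* When D_2 has only real roots, a common factor yields a common real root. It
   is a root of h_eliminant, hence one of finitely many x that do not depend on
   h, and a nonzero x is a root of D_1 for at most two values of h. *)
Lemma resultant_discP_neq0 q1 q2 : ga q1 != ga q2 ->
  (forall h, root (discP q1 h) 0 -> ~~ root (discP q2 h) 0) ->
  exists H, forall h e1 l r e4, H <= h -> oval_roots q2 h e1 l r e4 ->
    ga q2 != 0 -> resultant (discP q1 h) (discP q2 h) != 0.
Proof.
move=> g12 no0; have [rs Hrs] := poly_roots_list (h_eliminant_neq0 g12).
have [H HP] := discP_large_seq q1 rs.
exists H => h e1 l r e4 Hh orr g2.
have nr x : root (discP q2 h) x -> ~~ root (discP q1 h) x.
  move=> r2; apply/negP => r1.
  have [x0|x0] := eqVneq x 0.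
    by move: r2; rewrite x0 (negbTE (no0 h _)) // -x0.
  by have := HP h x Hh (Hrs _ (h_eliminant_root r1 r2)) x0; rewrite r1.
have DE := oval_roots_discP _ orr; have [_ D2 _ _] := orr.
have rt x : (x - e1) * (x - l) * (x - r) * (x - e4) = 0 -> root (discP q2 h) x.
  by move=> e; rewrite rootE DE e mulr0.
rewrite resultant_eq0 -leqNgt D2.
have : coprimep (discP q1 h) (ga q2 ^+ 2 *: (('X - e1%:P) * ('X - l%:P)
         * ('X - r%:P) * ('X - e4%:P))).
  rewrite coprimepZr ?expf_neq0 // !coprimepMr !coprimep_XsubC.
  by rewrite !nr //; apply: rt; rewrite subrr !(mul0r, mulr0).
by rewrite /coprimep => /eqP ->.
Qed.
End Resultants.

(** * Specialisation of discriminants and resultants at a level *)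

Section LynessResultants.
Context {R : realType} (k : nat) (a : nat -> R).
Context (hk : k = 2%N \/ k = 3%N).
Context (a_per : periodic k a).
Context (a_gt0 : forall n : nat, (1 <= n)%N -> 0 < a n).
Implicit Types (x h : R) (i j : nat).

Local Notation lq := (lyness_biquad k a).

Let qpos j : positive_biquad (lq j) := lyness_biquad_gt0 hk a_gt0 j.

Lemma ga_neq0 j : ga (lq j) != 0.
Proof. by have [[_ _ g _] _ _] := qpos j; rewrite gt_eqF. Qed.

Lemma level_polyE_quadratic j :
  let q := lyness_biquad k (fun n => (a n)%:P) j in
  level_poly k a j = (al q *: 'X + (be q)%:P) *: 'X^2
    + (poly_B0 q - 'X *: 'X) *: 'X
    + ((ze q *: 'X + (et q)%:P) * ('X + (th q)%:P))%:P.
Proof.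
rewrite /level_poly /lyness_num /lyness_num2 /lyness_num3 /poly_B0.
rewrite /lyness_biquad; case: hk => -> /=; rewrite -!mul_polyC;
  rewrite !(polyCD, polyCM, polyC_exp, polyCN, polyCB); ring.
Qed.

Lemma level_discE j :
  level_disc k a j = discP (lyness_biquad k (fun n => (a n)%:P) j) 'X.
Proof.
rewrite /level_disc level_polyE_quadratic /discriminant2 /discP /poly_4AC.
move: (poly_B0 _ - _) (_ *: 'X + _) (_ * ('X + _)) => B A C.
rewrite !coefD !coefZ !coefXn !coefX !coefC /=.
by rewrite !(mulr0, mulr1, add0r, addr0) -mul_polyC polyC_natr mulrA.
Qed.

Lemma map_level_disc j h :
  map_poly (horner_eval h) (level_disc k a j) = discP (lq j) h.
Proof.
rewrite level_discE /discP /poly_B0 /poly_4AC -!mul_polyC.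
rewrite !(rmorphB, rmorphD, rmorphM, rmorphXn) /=.
rewrite !(map_polyX, map_polyC) /= /horner_eval.
rewrite hornerX hornerC polyC1 !expr2.
by case: hk => ->; rewrite /lyness_biquad /=
  ?(hornerD, hornerM, horner_exp, hornerC).
Qed.

Lemma horner_level_disc j h x :
  (level_disc k a j).[x%:P].[h] = (discP (lq j) h).[x].
Proof.
rewrite -map_level_disc -[x in RHS](hornerC x h).
by rewrite -[x%:P.[h]]/(horner_eval h x%:P) horner_map.
Qed.

(** A resultant commutes with a specialisation that kills neither leading coefficient; here these
    are squares of [ga], nonzero constants in h. *)
Lemma horner_level_res i j h :
  (level_res k a i j).[h] = resultant (discP (lq i) h) (discP (lq j) h).
Proof.
have lc t : horner_eval h (lead_coef (level_disc k a t)) != 0.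
  rewrite level_discE; have [|_ ->] := @size_discP _
    (lyness_biquad k (fun n => (a n)%:P) t) 'X.
    by case: hk => ->; rewrite /lyness_biquad /= polyC_eq0 gt_eqF // a_gt0 //
       ?addn1 ?addn3.
  have := ga_neq0 t; rewrite /horner_eval horner_exp.
  by case: hk => ->; rewrite /lyness_biquad /= hornerC; exact: expf_neq0.
rewrite -!map_level_disc.
exact: (@map_resultant _ _ (horner_eval h) _ _ (lc i) (lc j)).
Qed.

Lemma root_level_res i j h x :
  root (discP (lq i) h) x -> root (discP (lq j) h) x ->
  root (level_res k a i j) h.
Proof.
move=> ri rj; rewrite rootE horner_level_res resultant_eq0.
have D0 : discP (lq i) h != 0.
  by rewrite -size_poly_eq0; have [-> _] := size_discP h (ga_neq0 i).
have : 'X - x%:P %| gcdp (discP (lq i) h) (discP (lq j) h).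
  by rewrite dvdp_gcd !dvdp_XsubCl ri rj.
by move/dvdp_leq; rewrite gcdp_eq0 (negbTE D0) size_XsubC; apply.
Qed.

End LynessResultants.

(** * Coincidences among the discriminants of one family *)

Section LynessPairs.
Context {R : realType} (k : nat) (a : nat -> R).
Context (hk : k = 2%N \/ k = 3%N).
Context (a_per : periodic k a).
Context (a_gt0 : forall n : nat, (1 <= n)%N -> 0 < a n).
Implicit Types (x h : R) (i j : nat).

Local Notation lq := (lyness_biquad k a).
Local Notation lo j := (proj_ends k a j).1.
Local Notation hi j := (proj_ends k a j).2.

Let qpos j : positive_biquad (lq j) := lyness_biquad_gt0 hk a_gt0 j.

Lemma a_wrap : a k.+1 = a 1%N /\ a k.+2 = a 2%N.
Proof. by split; [rewrite -(a_per (n := 1))|rewrite -(a_per (n := 2))]. Qed.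

(** Equal [ga] means two equal parameters. For k = 3 this can exchange linear factors between A and
    C, so only their product is compared. *)
Lemma same_ga i j : (i < k)%N -> (j < k)%N -> ga (lq i) = ga (lq j) ->
  poly_B0 (lq i) = poly_B0 (lq j) /\
  forall x, quadA (lq i) x * quadC (lq i) x = quadA (lq j) x * quadC (lq j) x.
Proof.
have [w1 w2] := a_wrap; rewrite /poly_B0 /quadA /quadC.
case: hk w1 w2 => ek; rewrite ek => w1 w2;
  case: i => [|[|[|i]]] //; case: j => [|[|[|j]]] // _ _ /=;
  rewrite /lyness_biquad /= ?add0n ?add1n ?add2n ?w1 ?w2 => e;
  rewrite ?e; split => [|x]; rewrite ?e //; try ring.
all: by congr (_ *: 'X^2 + _%:P); ring.
Qed.

Lemma same_ga_ends i j h : (i < k)%N -> (j < k)%N ->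
  ga (lq i) = ga (lq j) -> lo i h = lo j h.
Proof.
move=> ik jk /(same_ga ik jk)[e1 e2] /=; congr inf.
rewrite eqEsubset; split => x /level_projP - /(_ hk a_gt0)[x0 xh];
  apply/level_projP => //; split=> //; move: xh; rewrite /least_level e2;
  have : (poly_B0 (lq i)).[x] = (poly_B0 (lq j)).[x] by rewrite e1.
all: by rewrite /poly_B0 !(hornerD, hornerZ, hornerXn, hornerC) => ->.
Qed.

Lemma discP_root0 j h : root (discP (lq j) h) 0 ->
  if k == 2%N then a (j + 2)%N = a (j + 1)%N * a (j + 1)%N
  else a (j + 3)%N = a (j + 1)%N * a (j + 2)%N.
Proof.
move=> /rootP; rewrite horner_discP /quadA /quadB /quadC /lyness_biquad.
case: hk => -> /=; rewrite expr0n /= !mulr0 !add0r subr0 => e;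
  apply/eqP; rewrite -subr_eq0 -sqrf_eq0; apply/eqP; rewrite -[RHS]e; ring.
Qed.

(** Two relations of the form given by [discP_root0] yield (s - u)(1 + s + u) = 0 or (s - u)(1 + t)
    = 0 between positive parameters, hence equal [ga]. *)
Lemma discP_root0N i j h : (i < k)%N -> (j < k)%N -> ga (lq i) != ga (lq j) ->
  root (discP (lq i) h) 0 -> ~~ root (discP (lq j) h) 0.
Proof.
have H (s t u : R) : 0 < t -> s = t * u -> u = t * s -> s = u.
  move=> t0 e1 e2; apply/eqP; rewrite -subr_eq0.
  have : (s - u) * (1 + t) = 0 by lra.
  by move/eqP; rewrite mulf_eq0 => /orP[//|]; rewrite gt_eqF // addr_gt0.
have H2 (s u : R) : 0 < s -> 0 < u -> s = u * u -> u = s * s -> s = u.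
  move=> s0 u0 e1 e2; apply/eqP; rewrite -subr_eq0.
  have : (s - u) * (1 + s + u) = 0 by lra.
  by move/eqP; rewrite mulf_eq0 => /orP[//|]; rewrite gt_eqF // !addr_gt0.
have a1 : 0 < a 1%N by exact: a_gt0.
have a2 : 0 < a 2%N by exact: a_gt0.
have a3 : 0 < a 3%N by exact: a_gt0.
have [w1 w2] := a_wrap; move=> ik jk g.
move=> /discP_root0 e1; apply: contra g => /discP_root0 e2; apply/eqP.
move: e1 e2 ik jk.
rewrite /lyness_biquad; case: hk w1 w2 => -> w1 w2 /=;
  case: i => [|[|[|i]]] //; case: j => [|[|[|j]]] //=;
  rewrite ?add0n ?add1n ?add2n ?w1 ?w2 => e1 e2 _ _.
all: try by apply: H2; lra.
all: first [by apply: (H _ (a 1%N)); lra | by apply: (H _ (a 2%N)); lra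
           | by apply: (H _ (a 3%N)); lra].
Qed.

Lemma level_res_neq0 i j : (i < k)%N -> (j < k)%N -> ga (lq i) != ga (lq j) ->
  level_res k a i j != 0.
Proof.
move=> ik jk g.
have [H HP] := resultant_discP_neq0 g (fun h => @discP_root0N i j h ik jk g).
(* Large enough for [HP], and above the value of V at (1, 1), so nondegenerate. One nonzero value
   makes the polynomial nonzero. *)
pose h := Num.max H (lyness_V k a 0 1 1 + 1).
have nd : nondegenerate_level k a h.
  by exists 1, 1; split; rewrite ?ltr01 // lt_max ltrDl ltr01 orbT.
have [e1 [e4 [orr _]]] := level_oval hk a_per a_gt0 j nd.
have Hh : H <= h by rewrite le_max lexx.
have := HP h _ _ _ _ Hh orr (ga_neq0 hk a_gt0 j).
rewrite -horner_level_res //; apply: contraNneq => ->.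
by rewrite horner0.
Qed.

Lemma level_disc_ends j h : nondegenerate_level k a h ->
  (level_disc k a j).[(lo j h)%:P].[h] = 0 /\
  (level_disc k a j).[(hi j h)%:P].[h] = 0.
Proof.
move=> nd; have [e1 [e4 [orr _]]] := level_oval hk a_per a_gt0 j nd.
rewrite !horner_level_disc // !(oval_roots_discP _ orr) !subrr.
by rewrite !(mulr0, mul0r).
Qed.

Lemma bifurcation_resultant h : bifurcation_value k a h ->
  exists i j, [/\ (i < j)%N, (j < k)%N, level_res k a i j != 0
                & root (level_res k a i j) h].
Proof.
move=> [nd nloc].
have [i [j [ik [jk ij]]]] :
    exists i j, (i < k)%N /\ (j < k)%N /\ hi i h = lo j h.
  apply: contrapT => H; apply: nloc.
  apply: (level_projs_count_near hk a_per a_gt0 nd) => i j ik jk.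
  by apply/eqP => ij; apply: H; exists i, j.
(* Equal [ga] would give lo i = lo j = hi i, an interval of length zero. *)
have g : ga (lq i) != ga (lq j).
  apply/eqP => /(same_ga_ends h ik jk) e.
  have /andP[_] := proj_ends_lt hk a_per a_gt0 i nd.
  by rewrite e ij ltxx.
have ri : root (discP (lq i) h) (hi i h).
  by rewrite rootE -horner_level_disc // (level_disc_ends i nd).2.
have rj : root (discP (lq j) h) (hi i h).
  by rewrite rootE -horner_level_disc // ij (level_disc_ends j nd).1.
case: (ltngtP i j) => [lt|lt|e].
- exists i, j; split => //; first exact: level_res_neq0.
  exact: root_level_res ri rj.
- exists j, i; split => //; first by apply: level_res_neq0; rewrite // eq_sym.
  exact: root_level_res rj ri.
- by move: g; rewrite e eqxx.
Qed.
End LynessPairs.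

(** * The orbit *)

Section LynessOrbit.
Context {R : realType} (k : nat) (a x : nat -> R).
Context (hk : k = 2%N \/ k = 3%N).
Context (a_per : periodic k a).
Context (a_gt0 : forall n : nat, (1 <= n)%N -> 0 < a n).
Context (x1_gt0 : 0 < x 1%N) (x2_gt0 : 0 < x 2%N).
Context (x_rec : forall n : nat, (1 <= n)%N ->
  x (n + 2)%N = (a n + x (n + 1)%N) / x n).

Local Notation lq := (lyness_biquad k a).
Local Notation h := (lyness_V k a 0 (x 1%N) (x 2%N)).

Let qpos j : positive_biquad (lq j) := lyness_biquad_gt0 hk a_gt0 j.

Lemma lyness_iterE n : lyness_iter a n (x 1%N, x 2%N) = (x n.+1, x n.+2).
Proof.
elim: n => [//|n IH] /=; rewrite IH; congr (_, _).
by have := @x_rec n.+1 isT; rewrite addn2 addn1.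
Qed.

Lemma orbit_gt0 n : 0 < x n.+1.
Proof.
by have [] := @lyness_iter_gt0 _ _ a_gt0 n (x 1%N, x 2%N) x1_gt0 x2_gt0;
  rewrite lyness_iterE.
Qed.

Lemma orbit_V n : lyness_V k a n (x n.+1) (x n.+2) = h.
Proof.
by have := @lyness_iter_V _ _ _ hk a_per a_gt0 n (x 1%N, x 2%N) x1_gt0 x2_gt0;
  rewrite lyness_iterE.
Qed.

Lemma lyness_biquad_mod j : lq (j %% k) = lq j.
Proof.
rewrite {2}(divn_eq j k) addnC.
elim: (j %/ k)%N => [|m IH]; first by rewrite addn0.
by rewrite mulSn addnA addnAC lyness_biquad_per.
Qed.

Lemma lyness_V_mod j u v : lyness_V k a (j %% k) u v = lyness_V k a j u v.
Proof.
rewrite {2}(divn_eq j k) addnC.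
elim: (j %/ k)%N => [|m IH]; first by rewrite addn0.
by rewrite mulSn addnA addnAC lyness_V_per.
Qed.

Lemma k_gt0 : (0 < k)%N. Proof. by case: hk => ->. Qed.

(** Both halves come from ga x^2 + de < h x, that is B < 0 on the curve. *)
Lemma orbit_bounds n : de (lq n) < h * x n.+1 /\ ga (lq n) * x n.+1 < h.
Proof.
have x0 := orbit_gt0 n; have y0 := orbit_gt0 n.+1.
have /(lyness_V_eq _ hk _ _ x0 y0) P0 := orbit_V n.
have [B0 xh] := quadP_bound (qpos n) x0 y0 P0.
have [[_ _ ga0 de0] _ _] := qpos n.
split; last by rewrite mulrC -ltr_pdivlMr.
have : 0 < ga (lq n) * x n.+1 ^+ 2 by rewrite mulr_gt0 // exprn_gt0.
by move: B0; rewrite /quadB; lra.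
Qed.

Lemma level_gt0 : 0 < h.
Proof.
have [+ _] := orbit_bounds 0; have [[_ _ _ de0] _ _] := qpos 0.
by move=> /(lt_trans de0); rewrite pmulr_lgt0.
Qed.

Lemma orbit_persistent : persistent x.
Proof.
have h0 := level_gt0; have k0 := k_gt0.
have ga0 j : 0 < ga (lq j) by have [[]] := qpos j.
have de0 j : 0 < de (lq j) by have [[]] := qpos j.
(* The bounds depend on [n] only modulo [k]; a sum of positive terms serves as their common upper
   bound. *)
have sum_gt (f : nat -> R) n : (forall j, 0 < f j) ->
    f (n %% k)%N <= \sum_(j < k) f j.
  move=> f0; rewrite (bigD1 (Ordinal (ltn_pmod n k0))) //= lerDl.
  by apply: sumr_ge0 => j _; exact: ltW.
pose fC j := h / ga (lq j); pose fc j := h / de (lq j).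
have fC0 j : 0 < fC j by rewrite divr_gt0.
have fc0 j : 0 < fc j by rewrite divr_gt0.
exists (\sum_(j < k) fc j)^-1, (\sum_(j < k) fC j); split.
- by rewrite invr_gt0; apply: lt_le_trans (sum_gt fc 0%N fc0).
- by apply: lt_le_trans (sum_gt fC 0%N fC0).
case=> // n _; have [b1 b2] := orbit_bounds n; apply/andP; split.
  rewrite -[x n.+1]invrK ltf_pV2 ?posrE ?invr_gt0 ?orbit_gt0 //; last first.
    by apply: lt_le_trans (sum_gt fc 0%N fc0).
  apply: lt_le_trans (sum_gt fc n fc0).
  rewrite /fc lyness_biquad_mod -[X in X < _]mul1r ltr_pdivlMr //.
  by rewrite mulrAC ltr_pdivrMr ?orbit_gt0 // mul1r.
apply: lt_le_trans (sum_gt fC n fC0).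
by rewrite /fC lyness_biquad_mod ltr_pdivlMr // mulrC.
Qed.

Lemma orbit_periodic m : (0 < m)%N ->
  lyness_iter a (k * m) (x 1%N, x 2%N) = (x 1%N, x 2%N) ->
  exists p, [/\ (0 < p)%N, (k %| p)%N & periodic p x].
Proof.
move=> m0 e; exists (k * m)%N; split; first by rewrite muln_gt0 k_gt0.
  by rewrite dvdn_mulr.
case=> // n _; have := lyness_iterD a_per n (x 1%N, x 2%N) m.
by rewrite e !lyness_iterE addSn => -[].
Qed.

(* In logarithmic coordinates V is a positive combination of exponentials, so
   it is strictly convex: comparing two minima with their geometric mean shows
   that they coincide. *)
Lemma level_min_unique u v u' v' : 0 < u -> 0 < v -> 0 < u' -> 0 < v' ->
  lyness_V k a 0 u' v' = lyness_V k a 0 u v ->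
  (forall s t, 0 < s -> 0 < t -> lyness_V k a 0 u v <= lyness_V k a 0 s t) ->
  u = u' /\ v = v'.
Proof.
move=> u0 v0 u'0 v'0 e min.
have [[al0 be0 ga0 de0] [ze0 et0 th0] _] := qpos 0.
(* V in the square roots [p], [q] of the coordinates and their inverses [i], [j]: a positive
   combination of squares of monomials. *)
pose W (p q i j : R) := al (lq 0) * q ^+ 2 + be (lq 0) * (q * i) ^+ 2
  + ga (lq 0) * p ^+ 2 + de (lq 0) * i ^+ 2 + ze (lq 0) * (p * j) ^+ 2
  + (ze (lq 0) * th (lq 0) + et (lq 0)) * j ^+ 2
  + et (lq 0) * th (lq 0) * (i * j) ^+ 2.
have VE p q : 0 < p -> 0 < q ->
    lyness_V k a 0 (p ^+ 2) (q ^+ 2) = W p q p^-1 q^-1.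
  move=> p0 q0; rewrite /lyness_V -[lyness_num _ _ _ _ _](subr0).
  rewrite -[X in _ - X](mul0r (q ^+ 2)) -[X in _ - X * _](mul0r (p ^+ 2)).
  rewrite -quadP_lyness // /quadP /quadA /quadB /quadC /W; field.
  by rewrite !gt_eqF.
have sq (s : R) : 0 < s -> exists2 r, 0 < r & r ^+ 2 = s.
  by move=> s0; exists (Num.sqrt s); rewrite ?sqrtr_gt0 // sqr_sqrtr // ltW.
have [p p0 pE] := sq _ u0; have [q q0 qE] := sq _ v0.
have [p' p'0 p'E] := sq _ u'0; have [q' q'0 q'E] := sq _ v'0.
have [s s0 sE] := sq _ (mulr_gt0 p0 p'0).
have [t t0 tE] := sq _ (mulr_gt0 q0 q'0).
have := min (p * p') (q * q') (mulr_gt0 p0 p'0) (mulr_gt0 q0 q'0).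
have e' : W p' q' p'^-1 q'^-1 = W p q p^-1 q^-1.
  by rewrite -!VE // pE qE p'E q'E.
have Vst : lyness_V k a 0 (p * p') (q * q') = W s t s^-1 t^-1.
  by rewrite -sE -tE VE.
rewrite Vst -pE -qE VE // => le.
(* At the geometric mean the square of a monomial is the product of its values m and m' at the two
   points, and 2 m m' = m^2 + m'^2 - (m - m')^2. *)
have : 2 * W s t s^-1 t^-1 = W p q p^-1 q^-1 + W p' q' p'^-1 q'^-1
  - (al (lq 0) * (q - q') ^+ 2 + be (lq 0) * (q / p - q' / p') ^+ 2
  + ga (lq 0) * (p - p') ^+ 2 + de (lq 0) * (p^-1 - p'^-1) ^+ 2
  + ze (lq 0) * (p / q - p' / q') ^+ 2
  + (ze (lq 0) * th (lq 0) + et (lq 0)) * (q^-1 - q'^-1) ^+ 2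
  + et (lq 0) * th (lq 0) * (p^-1 / q - p'^-1 / q') ^+ 2).
  rewrite /W !exprMn !exprVn sE tE; field.
  by rewrite !gt_eqF.
rewrite e'; set d1 := al _ * _; set d2 := be _ * _; set d3 := ga _ * _.
set d4 := de _ * _; set d5 := ze _ * _ ^+ 2; set d6 := (_ + _) * _ ^+ 2.
set d7 := et _ * _ * _ => E.
have d10 : 0 <= d1 by rewrite mulr_ge0 ?sqr_ge0 // ltW.
have d20 : 0 <= d2 by rewrite mulr_ge0 ?sqr_ge0 // ltW.
have d30 : 0 <= d3 by rewrite mulr_ge0 ?sqr_ge0 // ltW.
have d40 : 0 <= d4 by rewrite mulr_ge0 ?sqr_ge0 // ltW.
have d50 : 0 <= d5 by rewrite mulr_ge0 ?sqr_ge0 // ltW.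
have d60 : 0 <= d6 by rewrite mulr_ge0 ?sqr_ge0 // ltW // addr_gt0 // mulr_gt0.
have d70 : 0 <= d7 by rewrite mulr_ge0 ?sqr_ge0 // ltW // mulr_gt0.
have /eqP : d1 = 0 by lra.
rewrite mulf_eq0 (gt_eqF al0) sqrf_eq0 subr_eq0 => /eqP qq.
have /eqP : d3 = 0 by lra.
rewrite mulf_eq0 (gt_eqF ga0) sqrf_eq0 subr_eq0 => /eqP pp.
by rewrite -p'E -q'E pp qq.
Qed.

(** Here (x 1, x 2) minimises V, and its image under k steps has the same value, so it is the same
    point. *)
Lemma degenerate_orbit : ~ nondegenerate_level k a h ->
  lyness_iter a (k * 1) (x 1%N, x 2%N) = (x 1%N, x 2%N).
Proof.
move=> deg; rewrite muln1 lyness_iterE.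
have [|s t s0 t0|-> -> //] := level_min_unique x1_gt0 x2_gt0 (orbit_gt0 k)
    (orbit_gt0 k.+1).
  by rewrite -(orbit_V k) -[k in RHS]add0n lyness_V_per.
by rewrite leNgt; apply/negP => lt; apply: deg; exists s, t.
Qed.

Lemma orbit_set_sub : orbit_set x `<=` level_projs k a h.
Proof.
move=> _ [[//|n] _ <-]; exists (n %% k)%N; first exact: ltn_pmod k_gt0.
exists (x n.+1, x n.+2) => //; split; rewrite ?orbit_gt0 //=.
by rewrite lyness_V_mod orbit_V.
Qed.

Lemma closed_level_projs : nondegenerate_level k a h ->
  closed (level_projs k a h).
Proof.
move=> nd; rewrite /level_projs bigcup_mkord; apply: closed_bigsetU => j _.
have [_ [_ [_ ->]]] := level_oval hk a_per a_gt0 j nd.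
exact: itv_closed.
Qed.

Lemma orbit_dichotomy : nondegenerate_level k a h ->
  (exists p, [/\ (0 < p)%N, (k %| p)%N & periodic p x]) \/
  closure (orbit_set x) = level_projs k a h.
Proof.
move=> nd.
have [e1 [e4 [[[e10 e1l lr re4] DE Bn Dlr] _]]] :=
  level_oval hk a_per a_gt0 0 nd.
have [u [v [uv [T [T0 uT vT]] surj]]] :=
  oval_flow (qpos 0) e10 e1l lr re4 DE Bn Dlr.
have [t0 [ut0 vt0]] := surj _ _ x1_gt0 x2_gt0
  (iffLR (lyness_V_eq _ hk _ _ x1_gt0 x2_gt0) erefl).
have [[m m0 per]|dense] :=
    lyness_iter_dichotomy hk a_per a_gt0 uv T0 uT vT surj; [left|right].
  by apply: (orbit_periodic m0); rewrite -ut0 -vt0 per.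
rewrite eqEsubset; split.
  rewrite ((closure_id _).1 (closed_level_projs nd)).
  exact/closure_subset/orbit_set_sub.
move=> z [j jk [[y w] [/= y0 w0 yw] <-]].
(* The point of the j-th curve is pulled back to the curve of index 0, where the flow reaches it at
   some time [t]. *)
have [p [p1 p2 pV pE]] := lyness_iter_surj hk a_per a_gt0 y0 w0 yw.
have [t [ut vt]] := surj _ _ p1 p2 (iffLR (lyness_V_eq _ hk _ _ p1 p2) pV).
pose g s := (lyness_iter a j (u s, v s)).1.
have gt : g t = y by rewrite /g ut vt -surjective_pairing pE.
have gC : {for t, continuous g}.
  have [dg _ _ _ _] := lyness_iter_flow hk a_per a_gt0 j uv t.
  exact: is_derive1_continuous dg.
move=> B; rewrite -gt => /gC [e /= e0 He].
(* After k n steps the orbit is at a time close to [t]; j further steps and the continuity of [g]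
   bring it close to [y]. *)
have [n [t' [tt' nE]]] := dense t0 t e e0.
exists (x (j + k * n).+1); split; first by exists (j + k * n).+1.
have := He t'; rewrite /ball_ /= distrC => /(_ tt').
rewrite /g -nE -lyness_iterD // ut0 vt0 lyness_iterE //.
Qed.
End LynessOrbit.

Theorem theorem1 (R : realType) (k : nat) (hk : k = 2%N \/ k = 3%N)
    (a x : nat -> R)
    (a_per : periodic k a)
    (a_gt0 : forall n : nat, (1 <= n)%N -> 0 < a n)
    (x1_gt0 : 0 < x 1%N) (x2_gt0 : 0 < x 2%N)
    (x_rec : forall n : nat, (1 <= n)%N ->
       x (n + 2)%N = (a n + x (n + 1)%N) / x n) :
  persistent x
  /\
  ((exists p : nat, [/\ (0 < p)%N, (k %| p)%N & periodic p x])
   \/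
   (exists m : nat, (1 <= m <= k)%N /\ densely_fills m x)
   /\ nondegenerate_level k a (lyness_V k a 0 (x 1%N) (x 2%N))
   /\ closure (orbit_set x)
      = level_projs k a (lyness_V k a 0 (x 1%N) (x 2%N)))
  /\
  (forall h : R, nondegenerate_level k a h ->
     (exists m : nat,
        (1 <= m <= k)%N /\ is_disjoint_intervals m (level_projs k a h))
     /\
     (forall j : nat, (j < k)%N ->
        exists l r : R,
          [/\ 0 < l, l < r, level_proj k a j h = `[l, r]%classic,
              (level_disc k a j).[l%:P].[h] = 0
            & (level_disc k a j).[r%:P].[h] = 0]))
  /\
  (forall h : R, bifurcation_value k a h ->
     exists i j : nat,
       [/\ (i < j)%N, (j < k)%N, level_res k a i j != 0
         & root (level_res k a i j) h])
  /\
  (forall (h1 h2 : R) (m1 m2 : nat),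
     nondegenerate_level k a h1 -> h1 < h2 ->
     is_disjoint_intervals m1 (level_projs k a h1) ->
     is_disjoint_intervals m2 (level_projs k a h2) ->
     m1 <> m2 ->
     exists h : R, [/\ h1 <= h, h <= h2 & bifurcation_value k a h]).
Proof.
split; first exact: (orbit_persistent hk a_per a_gt0 x1_gt0 x2_gt0 x_rec).
split.
  have [nd|deg] :=
    pselect (nondegenerate_level k a (lyness_V k a 0 (x 1%N) (x 2%N))).
    have [per|clo] := orbit_dichotomy hk a_per a_gt0 x1_gt0 x2_gt0 x_rec nd.
      by left.
    right; split=> //; have [m [mk dm]] := level_projs_count hk a_per a_gt0 nd.
    by exists m; split; rewrite // /densely_fills clo.
  (* At the minimum of V the orbit has period k, the case m = 1. *)
  left; apply: (orbit_periodic hk a_per x_rec (ltnSn 0)).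
  exact: (degenerate_orbit hk a_per a_gt0 x1_gt0 x2_gt0 x_rec deg).
split.
  move=> h nd; split; first exact: (level_projs_count hk a_per a_gt0 nd).
  move=> j _; have [e1 [e4 [_ pE]]] := level_oval hk a_per a_gt0 j nd.
  have /andP[l0 lr] := proj_ends_lt hk a_per a_gt0 j nd.
  have [dl dr] := level_disc_ends hk a_per a_gt0 j nd.
  by exists ((proj_ends k a j).1 h), ((proj_ends k a j).2 h).
split; first by move=> h; exact: (bifurcation_resultant hk a_per a_gt0).
move=> h1 h2 m1 m2 nd1 h12 d1 d2; exact: (bifurcation_between nd1 h12 d1 d2).
Qed.
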